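(* Let $X$ be a complex Banach space, $n\ge 1$, $a_1,\ldots,a_n\in\mathbb{C}$, and let $D:\mathcal{C}^n(\mathbb{R},X)\to\mathcal{C}(\mathbb{R},X)$ be $D(y)=y^{(n)}+a_1y^{(n-1)}+\cdots+a_ny$. Suppose the characteristic polynomial $P(z)=z^n+a_1z^{n-1}+\cdots+a_n$ has $n$ distinct roots $r_1,\ldots,r_n$, all with $\operatorname{Re} r_k\neq 0$. Let $V=V(r_1,\ldots,r_n)$ and $V_k=V(r_1,\ldots,r_{k-1},r_{k+1},\ldots,r_n)$ for $1\le k\le n$. Then the best Ulam constant $K_D$ of $D$ exists and is given by: (i) if $\operatorname{Re} r_k>0$ for all $1\le k\le n$: $K_D=\frac{1}{|V|}\int_0^\infty\Big|\sum_{k=1}^n(-1)^kV_ke^{-r_kx}\Big|\,dx$; (ii) if $\operatorname{Re} r_k<0$ for all $1\le k\le n$: $K_D=\frac{1}{|V|}\int_0^\infty\Big|\sum_{k=1}^n(-1)^kV_ke^{r_kx}\Big|\,dx$; (iii) if, for some $1\le p<n$ (after labeling the roots accordingly), $\operatorname{Re} r_k>0$ for $1\le k\le p$ and $\operatorname{Re} r_k<0$ for $p+1\le k\le n$: $K_D=\frac{1}{|V|}\int_0^\infty\Big(\Big|\sum_{k=1}^p(-1)^kV_ke^{-r_kx}\Big|+\Big|\sum_{k=p+1}^n(-1)^kV_ke^{r_kx}\Big|\Big)dx$.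
   Context: $\mathcal{C}^n(\mathbb{R},X)$ is the space of $n$ times differentiable functions $\mathbb{R}\to X$ with continuous $n$-th derivative, $\mathcal{C}(\mathbb{R},X)=\mathcal{C}^0(\mathbb{R},X)$; both are equipped with the gauge $\|f\|_\infty=\sup_{t\in\mathbb{R}}\|f(t)\|\in[0,\infty]$. For numbers $x_1,\ldots,x_m$, $V(x_1,\ldots,x_m)=\det(x_j^{i-1})_{1\le i,j\le m}=\prod_{1\le i<j\le m}(x_j-x_i)$ is the Vandermonde determinant (equal to $1$ when $m\le 1$). $\operatorname{Ker}D=\{y: D(y)=0\}$. A number $K\ge0$ is an Ulam constant of $D$ if for every $\varepsilon>0$ and every $y\in\mathcal{C}^n(\mathbb{R},X)$ with $\|D(y)\|_\infty\le\varepsilon$ there exists $z\in\operatorname{Ker}D$ with $\|y-z\|_\infty\le K\varepsilon$; $D$ is Ulam stable if it has an Ulam constant. $K_D$ denotes the infimum of all Ulam constants of $D$; when this infimum is itself an Ulam constant it is called the best Ulam constant of $D$.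
   Formalization: The formal theorem assumes that the Banach space X is nonzero; for X = {0} every K ≥ 0 is an Ulam constant, so K_D = 0 while the stated integrals are positive. *)

(* Defs.v *)
From HB Require Import structures.
From mathcomp Require Import all_boot all_order all_algebra.
From mathcomp Require Import all_classical all_reals all_analysis.
From mathcomp Require Import complex.
Set Implicit Arguments. Unset Strict Implicit. Unset Printing Implicit Defensive.
Import Order.TTheory GRing.Theory Num.Theory.
Import numFieldNormedType.Exports.
Local Open Scope classical_set_scope.
Local Open Scope ring_scope.
Local Open Scope complex_scope.

Section Defs.
Variables (R : realType) (X : completeNormedModType R[i]).

Definition dquot (f : R -> X) (t : R) : R -> X :=
  fun h => (h%:C)^-1 *: (f (t + h) - f t).

Definition derivableX (f : R -> X) (t : R) : Prop := cvg (dquot f t @ 0%R^').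

Definition derivX (f : R -> X) : R -> X := fun t => lim (dquot f t @ 0%R^').

Definition derivnX (k : nat) (f : R -> X) : R -> X := iter k derivX f.

Definition Cn (n : nat) (f : R -> X) : Prop :=
  (forall k, (k < n)%N -> forall t, derivableX (derivnX k f) t) /\
  continuous (derivnX n f).

Definition Lop (n : nat) (a : 'I_n -> R[i]) (y : R -> X) : R -> X :=
  fun t => derivnX n y t + \sum_(i < n) a i *: derivnX (n - i.+1) y t.

Definition is_Ulam_constant (n : nat) (a : 'I_n -> R[i]) (K : R) : Prop :=
  (0 <= K)%R /\
  forall eps : R, (0 < eps)%R -> forall y, Cn n y ->
    (forall t, `|Lop a y t| <= eps%:C) ->
    exists z, Cn n z /\ (forall t, Lop a z t = 0) /\
      (forall t, `|y t - z t| <= (K * eps)%:C).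

Definition is_best_Ulam_constant (n : nat) (a : 'I_n -> R[i]) (K : R) : Prop :=
  is_Ulam_constant a K /\ forall K', is_Ulam_constant a K' -> (K <= K')%R.
End Defs.

Section Defs2.
Variable R : realType.
Definition charpoly (n : nat) (a : 'I_n -> R[i]) : {poly R[i]} :=
  'X^n + \sum_(i < n) (a i)%:P * 'X^(n - i.+1).

Definition vandermonde (s : seq R[i]) : R[i] :=
  \prod_(i < size s) \prod_(j < size s | (i < j)%N) (s`_j - s`_i).

Definition Vand (n : nat) (r : 'I_n -> R[i]) : R[i] := vandermonde [seq r i | i <- enum 'I_n].
Definition Vand_del (n : nat) (r : 'I_n -> R[i]) (k : 'I_n) : R[i] :=
  vandermonde [seq r i | i <- enum 'I_n & i != k].

Definition cexp (z : R[i]) : R[i] := (expR (complex.Re z))%:C * (cos (complex.Im z) +i* sin (complex.Im z)).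
End Defs2.

(* Main.v *)
Require Import Defs.
From HB Require Import structures.
From mathcomp Require Import all_boot all_order all_algebra.
From mathcomp Require Import all_classical all_reals all_analysis.
From mathcomp Require Import measurable_realfun complex ring lra.
Import Order.TTheory GRing.Theory Num.Theory.
Import numFieldNormedType.Exports.
Local Open Scope classical_set_scope.
Local Open Scope ring_scope.
Local Open Scope complex_scope.
Set Implicit Arguments.
Unset Strict Implicit.

(* With [c_k = 1 / P'(r_k)], Lagrange interpolation at the roots splits
   [y = sum_k c_k w_k], where [w_k = prod_(j != k) (d/dt - r_j) y] solves the
   first order equation [w_k' = r_k w_k + D y].  If [D y] is bounded, then
   [w_k] is asymptotic at one end of the line to some [exp (r_k t) L_k] and
   stays at bounded distance from it; [z = sum_k c_k exp (r_k t) L_k] is the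
   required element of the kernel.  So one may assume that all [w_k] are bounded.
   For the roots with positive real part,
   [F s = sum_k c_k exp (- r_k s) w_k s] then satisfies [F' = g f] with [f = D y]
   and [g s = sum_k c_k exp (- r_k s)], and [F] vanishes at infinity.  The mean
   value inequality against a primitive of [|g|] bounds [F 0] by [|f| * int |g|]
   without any vector valued integral; time reversal handles the other roots.
   This bound is optimal: take for [f] a continuous approximation of the phase
   opposite to [g].  Elements of the kernel at finite distance from the resulting
   bounded solution are bounded sums of exponentials with nonzero real parts,
   hence zero.  Finally [c_k = +- V_k / V]. *)

Set Implicit Arguments.
Unset Strict Implicit.

(** * Real-valued norms and differentiation along the real line *)

Section Derivative.
Context {R : realType}.

(** Norms over [R[i]] take complex values; [nm] is the underlying real number, so that estimates
    take place in the ordered field [R]. *)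
Definition nm {V : normedModType R[i]} (x : V) : R := complex.Re `|x|.

Section Norm.
Context {V : normedModType R[i]}.
Implicit Types (x y : V) (c : R[i]).

Lemma nmE x : `|x| = (nm x)%:C.
Proof. by rewrite /nm RRe_real // ger0_real. Qed.

Lemma nm_ge0 x : 0 <= nm x.
Proof. by rewrite -lecR -nmE; exact: normr_ge0. Qed.

Lemma ler_nmD x y : nm (x + y) <= nm x + nm y.
Proof. by rewrite -lecR rmorphD /= -!nmE ler_normD. Qed.

Lemma nmN x : nm (- x) = nm x.
Proof. by rewrite /nm normrN. Qed.

Lemma nm_eq0 x : nm x <= 0 -> x = 0.
Proof. by rewrite -lecR -nmE normr_le0 => /eqP. Qed.

Lemma nm0 : nm (0 : V) = 0.
Proof. by rewrite /nm normr0. Qed.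

Lemma nmZ c x : nm (c *: x) = Normc.normc c * nm x.
Proof.
by apply: (@complexI R); rewrite -nmE normrZ nmE rmorphM.
Qed.

Lemma nm_distC x y : nm (x - y) = nm (y - x).
Proof. by rewrite /nm distrC. Qed.

Lemma ler_nm_dist x y : nm x - nm y <= nm (x - y).
Proof. by rewrite lerBlDr (le_trans _ (ler_nmD _ _)) // subrK. Qed.

Lemma ler_nm_sum (I : finType) (P : pred I) (F : I -> V) :
  nm (\sum_(i | P i) F i) <= \sum_(i | P i) nm (F i).
Proof.
elim/big_ind2: _ => [|a b c d ab cd|//]; first by rewrite nm0.
by rewrite (le_trans (ler_nmD _ _)) // lerD.
Qed.

Lemma cvgNmP {T : Type} (F : set_system T) (FF : Filter F) (f : T -> V) (l : V) :
  f x @[x --> F] --> l <->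
  (forall e : R, 0 < e -> \forall x \near F, nm (f x - l) <= e).
Proof.
split=> [/cvgrPdist_le fl e e0|fl].
  have := fl e%:C; rewrite ltcR => /(_ e0).
  by apply: filterS => x; rewrite distrC nmE lecR.
apply/cvgrPdist_le => e e0.
have eE : e = (complex.Re e)%:C by rewrite RRe_real // gtr0_real.
move: e0; rewrite eE ltcR => e0.
by have := fl _ e0; apply: filterS => x; rewrite distrC nmE lecR.
Qed.

End Norm.

Lemma nm_real (x : R) : nm (x%:C : R[i]^o) = `|x|.
Proof. by rewrite /nm normc_def /= expr0n addr0 sqrtr_sqr. Qed.

Lemma normc_real (x : R) : Normc.normc x%:C = `|x|.
Proof. by rewrite /= expr0n addr0 sqrtr_sqr. Qed.

Lemma nm_normc (z : R[i]^o) : nm z = Normc.normc z.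
Proof. by []. Qed.

Lemma normc_ge0 (z : R[i]) : 0 <= Normc.normc z.
Proof. exact: (nm_ge0 (z : R[i]^o)). Qed.

(** A relation instead of a [lim], so that calculus rules carry existence and value together. The
    quotient is that of [dquot], hence [derivableX] and [derivX] convert to it. *)
Definition hasD {V : normedModType R[i]} (f : R -> V) (t : R) (l : V) : Prop :=
  (h%:C)^-1 *: (f (t + h) - f t) @[h --> (0 : R)^'] --> l.

Section HasD.
Context {V : normedModType R[i]}.
Implicit Types (f g : R -> V) (t : R) (l : V).

(** First-order expansion without division: it also holds at [h = 0], so the punctured neighbourhood
    disappears. *)
Lemma hasDP f t l : hasD f t l <->
  forall e : R, 0 < e -> exists2 d : R, 0 < d &
    forall h, `|h| < d -> nm (f (t + h) - f t - h%:C *: l) <= e * `|h|.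
Proof.
have E (h : R) : h != 0 -> nm (f (t + h) - f t - h%:C *: l) =
    nm (((h%:C)^-1 *: (f (t + h) - f t)) - l) * `|h|.
  move=> h0; rewrite -normc_real mulrC -nmZ scalerBr scalerA divff ?scale1r //.
  by rewrite -(rmorph0 (real_complex R)) (inj_eq (@complexI R)).
split=> [/cvgNmP fl e e0|fl].
  have := fl e e0; rewrite near_withinE => /nbhs_ballP[d /= d0 dP].
  exists d => // h hd; have [->|h0] := eqVneq h 0.
    by rewrite addr0 subrr scale0r subrr nm0 normr0 mulr0.
  rewrite E // ler_wpM2r // dP // /ball /= sub0r normrN //.
apply/cvgNmP => e e0; rewrite near_withinE.
have [d d0 dP] := fl e e0; apply/nbhs_ballP; exists d => //= h.
rewrite /ball /= sub0r normrN => hd h0.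
by rewrite -(ler_pM2r (x := `|h|)) ?normr_gt0 // -E // dP.
Qed.

Lemma hasD_cst (x : V) t : hasD (fun=> x) t 0.
Proof.
apply/hasDP => e e0; exists 1 => // h _.
by rewrite subrr scaler0 subr0 nm0 mulr_ge0 // ltW.
Qed.

Lemma hasD_cvg f t l : hasD f t l -> f h @[h --> t] --> f t.
Proof.
move=> /hasDP /(_ 1 ltr01)[d d0 dP]; apply/cvgNmP => e e0.
have c0 : 0 < 1 + nm l by rewrite ltr_pwDl // nm_ge0.
apply/nbhs_ballP; exists (Num.min d (e / (1 + nm l))) => /=.
  by rewrite lt_min d0 divr_gt0.
move=> x; rewrite /ball /= lt_min => /andP[xd xe].
have := dP (x - t); rewrite distrC => /(_ xd); rewrite [t + _]addrC subrK => hx.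
have -> : f x - f t = (f x - f t - (x - t)%:C *: l) + (x - t)%:C *: l.
  by rewrite subrK.
rewrite (le_trans (ler_nmD _ _)) // nmZ normc_real distrC.
rewrite (le_trans (lerD hx (lexx _))) // mul1r mulrC -{1}(mul1r `|_|) -mulrDl.
by rewrite -ler_pdivlMl // mulrC ltW.
Qed.

Lemma hasD_ext f g t l : f =1 g -> hasD f t l -> hasD g t l.
Proof. by move=> /funext ->. Qed.

Lemma hasD_eq f t l l' : hasD f t l -> l = l' -> hasD f t l'.
Proof. by move=> + <-. Qed.

Lemma hasD_D f g t a b :
  hasD f t a -> hasD g t b -> hasD (fun s => f s + g s) t (a + b).
Proof.
move=> fa gb; rewrite /hasD.
under eq_fun do rewrite opprD addrACA scalerDr.
exact: cvgD fa gb.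
Qed.

Lemma hasD_Z (u : R -> R[i]^o) f t a b :
  hasD u t a -> hasD f t b ->
  hasD (fun s => u s *: f s) t (a *: f t + u t *: b).
Proof.
move=> ua fb; rewrite /hasD.
have -> : (fun h : R => (h%:C)^-1 *: (u (t + h) *: f (t + h) - u t *: f t)) =
   (fun h : R => ((h%:C)^-1 * (u (t + h) - u t)) *: f (t + h) +
     u t *: ((h%:C)^-1 *: (f (t + h) - f t))).
  apply/funext => h; rewrite -[in RHS]scalerA [u t *: (_ *: _)]scalerA mulrC.
  by rewrite -[in RHS]scalerA -scalerDr scalerBl [u t *: (_ - _)]scalerBr addrA subrK.
apply: cvgD; last exact: cvgZr.
apply: cvgZ; first exact: ua.
apply: (cvg_comp (fun h => t + h) f _ (hasD_cvg fb)).
move=> A /nbhs_ballP[d /= d0 dA].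
suff : \forall h \near (0 : R)^', A (t + h) by [].
rewrite near_withinE.
apply/nbhs_ballP; exists d => //= h; rewrite /ball /= sub0r normrN => hd _.
by apply: dA; rewrite /ball /= opprD addrA subrr sub0r normrN.
Qed.

End HasD.

Section HasDTheory.
Context {V : normedModType R[i]}.
Implicit Types (f g : R -> V) (t : R) (l : V).

Lemma hasD_Zr (c : R[i]) f t l : hasD f t l -> hasD (fun s => c *: f s) t (c *: l).
Proof.
move=> fl; apply: (hasD_eq (hasD_Z (hasD_cst (c : R[i]^o) t) fl)).
by rewrite scale0r add0r.
Qed.

Lemma hasD_Zl (u : R -> R[i]^o) (e : V) t (a : R[i]) :
  hasD u t a -> hasD (fun s => u s *: e) t (a *: e).
Proof.
move=> ua; apply: (hasD_eq (hasD_Z ua (hasD_cst e t))).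
by rewrite scaler0 addr0.
Qed.

Lemma hasD_B f g t a b :
  hasD f t a -> hasD g t b -> hasD (fun s => f s - g s) t (a - b).
Proof.
move=> fa gb; apply: (hasD_ext (f := fun s => f s + (- 1) *: g s)).
  by move=> s; rewrite scaleN1r.
by rewrite -[- b]scaleN1r; apply: hasD_D => //; exact: hasD_Zr.
Qed.

Lemma hasD_sum (I : finType) (P : pred I) (F : I -> R -> V) (l : I -> V) t :
  (forall i, P i -> hasD (F i) t (l i)) ->
  hasD (fun s => \sum_(i | P i) F i s) t (\sum_(i | P i) l i).
Proof.
move=> H; pose u i := if P i then F i else fun=> 0.
apply: (hasD_ext (f := \sum_(i | P i) F i)).
  by move=> s; rewrite fct_sumE.
elim/big_rec2: _ => [|i y1 y2 Pi]; first exact: hasD_cst.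
by move=> h; exact: hasD_D (H i Pi) h.
Qed.

Lemma hasD_shift c f t l : hasD f (c + t) l -> hasD (fun s => f (c + s)) t l.
Proof. by rewrite /hasD; under [in X in _ -> X]eq_fun do rewrite addrA. Qed.

Lemma hasD_comp_opp f t l : hasD f (- t) l -> hasD (fun s => f (- s)) t (- l).
Proof.
move=> /hasDP H; apply/hasDP => e /H[d d0 dP]; exists d => // h hd.
have := dP (- h); rewrite normrN => /(_ hd).
by rewrite opprD rmorphN /= scaleNr opprK scalerN opprK.
Qed.

Lemma hasD_real (phi : R -> R) (t l : R) : is_derive t 1 phi l ->
  hasD (fun s => (phi s)%:C : R[i]^o) t l%:C.
Proof.
move=> [dphi dl].
have H : h^-1 *: (phi (h *: 1 + t) - phi t) @[h --> (0 : R)^'] --> l.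
  by rewrite -dl; exact: dphi.
apply/cvgNmP => e e0; move/cvgrPdist_le : H => /(_ e e0).
apply: filterS => h; rewrite distrC -nm_real; congr (_ <= _).
congr nm; rewrite rmorphB /=; congr (_ - _).
by rewrite rmorphM fmorphV rmorphB /= scaler1 [h + t]addrC.
Qed.

End HasDTheory.

End Derivative.

(** * Mean value inequality for vector-valued functions *)

Section MeanValue.
Context {R : realType}.

(** Let [c] be the supremum of the points of [[a, b]] where [N] is at most [N a]. Comparison with
    points just left of [c] puts [c] in this set; comparison with points just right of [c] exceeds
    the supremum unless [c = b]. *)
Lemma locally_nonincreasing (N : R -> R) (a b : R) : a <= b ->
  (forall c, a <= c <= b -> exists2 d : R, 0 < d & forall s, `|s - c| < d ->
    (s <= c -> N c <= N s) /\ (c <= s -> N s <= N c)) ->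
  N b <= N a.
Proof.
move=> ab H.
pose A := [set t | a <= t <= b /\ N t <= N a].
have Aa : A a by split; rewrite ?lexx.
have supA : has_sup A by split; [exists a|exists b => t [/andP[]]].
pose c := sup A.
have ac : a <= c by apply: sup_upper_bound.
have cb : c <= b by apply: ge_sup => [|t [/andP[]]//]; exists a.
have [|d d0 dP] := H c; first by rewrite ac cb.
have [s [/andP[as_ sb] Ns] cs] := sup_adherent d0 supA.
have sc : s <= c by apply: sup_upper_bound => //; split => //; apply/andP.
have Nc : N c <= N a.
  apply: le_trans Ns; apply: (dP s _).1 => //.
  by rewrite distrC ger0_norm ?subr_ge0 // ltrBlDl -ltrBlDr.
move: cb; rewrite le_eqVlt => /predU1P[<-//|cb].
pose t := Num.min b (c + d / 2).
have ct : c < t by rewrite lt_min cb ltrDl divr_gt0.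
suff At : A t by have := sup_upper_bound supA At; rewrite leNgt ct.
split; first by rewrite (le_trans ac (ltW ct)) ge_min lexx.
apply: le_trans Nc; apply: (dP t _).2; last exact: ltW.
rewrite ger0_norm ?subr_ge0 1?ltW // ltrBlDl gt_min; apply/orP; right.
by rewrite ltrD2l ltr_pdivrMr // ltr_pMr // ltr1n.
Qed.

(** A slack of slope [eta] absorbs the first-order errors of [f] and [psi], each at most [eta / 2]
    per unit of time. This makes [N] in the proof locally nonincreasing. *)
Lemma mean_value_ineq {V : normedModType R[i]} (f f' : R -> V)
    (psi psi' : R -> R) (a b : R) : a <= b ->
  (forall t, a <= t <= b -> hasD f t (f' t)) ->
  (forall t, a <= t <= b -> is_derive t 1 psi (psi' t)) ->
  (forall t, a <= t <= b -> nm (f' t) <= psi' t) ->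
  nm (f b - f a) <= psi b - psi a.
Proof.
move=> ab df dpsi fpsi; apply/ler_addgt0Pr => e e0.
(* The [1 +] covers the case [a = b]; the slack over the whole interval is then at most [e]. *)
have c0 : 0 < e / (1 + (b - a)) by rewrite divr_gt0 // ltr_pwDl // subr_ge0.
pose eta := e / (1 + (b - a)).
suff : nm (f b - f a) <= psi b - psi a + eta * (b - a).
  move=> h; rewrite (le_trans h) // lerD2l /eta -mulrAC ler_pdivrMr; last first.
    by rewrite ltr_pwDl // subr_ge0.
  by apply: ler_wpM2l; [exact: ltW|rewrite lerDr].
pose N t := nm (f t - f a) - psi t - eta * t.
suff : N b <= N a by rewrite /N subrr nm0; lra.
apply: locally_nonincreasing => // c cab.
have h0 : 0 < eta / 2 by rewrite divr_gt0.
have [d1 d10 H1] := (hasDP _ _ _).1 (df c cab) _ h0.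
have [d2 d20 H2] := (hasDP _ _ _).1 (hasD_real (dpsi c cab)) _ h0.
exists (Num.min d1 d2) => [|s]; first by rewrite lt_min d10.
rewrite lt_min => /andP[/H1 {}H1 /H2 {}H2].
move: H1; rewrite [c + _]addrC subrK => H1.
have {}H2 : `|psi s - psi c - (s - c) * psi' c| <= eta / 2 * `|s - c|.
  by move: H2; rewrite [c + _]addrC subrK -nm_real !(rmorphB, rmorphM).
have {}H1 : nm (f s - f c) <= eta / 2 * `|s - c| + `|s - c| * psi' c.
  rewrite -(subrK ((s - c)%:C *: f' c) (f s - f c)).
  rewrite (le_trans (ler_nmD _ _)) // lerD // nmZ normc_real.
  by rewrite ler_wpM2l // fpsi.
have T1 : nm (f s - f a) <= nm (f s - f c) + nm (f c - f a).
  by rewrite (le_trans _ (ler_nmD _ _)) // addrA subrK.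
have T2 : nm (f c - f a) <= nm (f s - f c) + nm (f s - f a).
  by rewrite [nm (f s - f c)]nm_distC (le_trans _ (ler_nmD _ _)) // addrA subrK.
rewrite ler_norml in H2; case/andP: H2 => H2 H3.
rewrite /N; split=> sc.
  have := sc; rewrite -subr_le0 => /ler0_norm E; rewrite E in H1 H2 H3; nra.
have := sc; rewrite -subr_ge0 => /ger0_norm E; rewrite E in H1 H2 H3; nra.
Qed.

End MeanValue.

(** * The complex exponential along the real line *)

Section ComplexExponential.
Context {R : realType}.

Lemma cexpD (z w : R[i]) : cexp (z + w) = cexp z * cexp w.
Proof.
case: z => a b; case: w => c d; rewrite /cexp /= expRD cosD sinD.
by apply/eqP; rewrite eq_complex /=; apply/andP; split; apply/eqP; ring.
Qed.

Lemma cexp0 : cexp (0 : R[i]) = 1.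
Proof.
rewrite /cexp /= expR0 cos0 sin0.
by apply/eqP; rewrite eq_complex /=; apply/andP; split; apply/eqP; ring.
Qed.

Lemma normc_cexp (z : R[i]) : Normc.normc (cexp z) = expR (complex.Re z).
Proof.
rewrite /cexp Normc.normcM normc_real ger0_norm ?expR_ge0 //=.
by rewrite cos2Dsin2 sqrtr1 mulr1.
Qed.

Lemma cexpN (z : R[i]) : cexp (- z) * cexp z = 1.
Proof. by rewrite -cexpD addNr cexp0. Qed.

Lemma Re_mulC (z : R[i]) (t : R) : complex.Re (z * t%:C) = complex.Re z * t.
Proof. by case: z => a b /=; rewrite mulr0 subr0. Qed.

Lemma Im_mulC (z : R[i]) (t : R) : complex.Im (z * t%:C) = complex.Im z * t.
Proof. by case: z => a b /=; rewrite mulr0 add0r. Qed.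

Lemma hasD_complex (u v : R -> R) (t u' v' : R) :
  is_derive t 1 u u' -> is_derive t 1 v v' ->
  hasD (fun s => (u s +i* v s) : R[i]^o) t (u' +i* v').
Proof.
move=> du dv.
have E (x y : R) : x +i* y = x%:C + 'i * y%:C.
  by apply/eqP; rewrite eq_complex /=; apply/andP; split; apply/eqP; ring.
have H := hasD_D (hasD_real du) (hasD_Zr (c := 'i) (hasD_real dv)).
by rewrite E; apply: hasD_ext H => s; rewrite E.
Qed.

Lemma hasD_cexp (r : R[i]) (t : R) :
  hasD (fun s => cexp (r * s%:C) : R[i]^o) t (r * cexp (r * t%:C)).
Proof.
case: r => a b.
apply: (@hasD_ext R R[i]^o (fun s => (expR (a * s) * cos (b * s)) +i*
    (expR (a * s) * sin (b * s)))).
  move=> s; rewrite /cexp Re_mulC Im_mulC /=.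
  by apply/eqP; rewrite eq_complex /=; apply/andP; split; apply/eqP; ring.
apply: hasD_eq; first by apply: hasD_complex.
rewrite /cexp Re_mulC Im_mulC /= /GRing.scale /=.
by apply/eqP; rewrite eq_complex /=; apply/andP; split; apply/eqP; ring.
Qed.

End ComplexExponential.
Arguments hasD_cexp {R} r t.

(** * Decaying real exponentials *)

Section RealExponential.
Context {R : realType}.

Lemma is_derive_expRN (a t : R) :
  is_derive t 1 (fun s => expR (- (a * s))) (- (a * expR (- (a * t)))).
Proof.
have H : is_derive t 1 (fun s : R => - (a * s)) (- a).
  by apply: is_derive_eq; rewrite scaler1.
by apply: is_derive_eq; rewrite /GRing.scale /=; ring.
Qed.

Lemma cvg_expRN (a : R) : 0 < a -> expR (- (a * t)) @[t --> +oo] --> (0 : R).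
Proof.
move=> a0; apply: (cvg_comp (fun t => a * t) (fun x => expR (- x)) _ (@cvgr_expR R)).
exact: gt0_cvgMry.
Qed.

End RealExponential.

(** * First order equations with bounded right-hand side *)

Section BoundedSolution.
Context {R : realType} {X : completeNormedModType R[i]}.

(** The decay makes [W] Cauchy at infinity, and completeness of [X] provides [L]; the bound follows
    by letting [t] tend to infinity. *)
Lemma exp_cauchy_lim (W : R -> X) (C a : R) : 0 < a ->
  (forall s t, s <= t -> nm (W t - W s) <= C * expR (- (a * s))) ->
  exists L, forall s, nm (W s - L) <= C * expR (- (a * s)).
Proof.
move=> a0 H.
have C0 : C * expR (- (a * t)) @[t --> +oo] --> (0 : R).
  by rewrite -[0](mulr0 C); apply: cvgM; [exact: cvg_cst|exact: cvg_expRN].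
have /cauchy_cvgP/cvg_ex[L WL] : cauchy (W @ (+oo : set_system R)).
  apply: cauchy_exP => e e0.
  have eE : e = (complex.Re e)%:C by rewrite RRe_real // gtr0_real.
  move: e0; rewrite eE ltcR => e0.
  have [t0 tP] : \forall t \near +oo, C * expR (- (a * t)) < complex.Re e.
    exact: cvgr_lt C0 _ e0.
  exists (W (t0 + 1)); exists (t0 + 1); split; first by rewrite num_real.
  move=> t /ltW tt; rewrite -ball_normE /= distrC nmE ltcR.
  by apply: le_lt_trans (H _ _ tt) _; apply: tP.2; rewrite ltrDl.
exists L => s; apply/ler_addgt0Pr => e e0.
move/cvgNmP : WL => /(_ e e0)[t0 [_ tP]].
pose t := Num.max s (t0 + 1).
have tt : t0 < t by rewrite lt_max ltrDl ltr01 orbT.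
have st : s <= t by rewrite le_max lexx.
rewrite -(subrK (W t) (W s)) -addrA (le_trans (ler_nmD _ _)) // lerD //.
  by rewrite nm_distC H.
exact: tP.
Qed.

(** The derivative of [exp (- r t) w] is [exp (- r t) f], of norm at most [e * exp (- a t)] with [a]
    the real part of [r]. The variation after time [s] is thus at most [e / a * exp (- a s)], and
    multiplying back by [exp (r s)] leaves [e / a]. *)
Lemma ode_asymptotics_gt0 (r : R[i]) (w f : R -> X) (e : R) :
  0 < complex.Re r -> (forall t, hasD w t (r *: w t + f t)) ->
  (forall t, nm (f t) <= e) ->
  exists L, forall t, nm (w t - cexp (r * t%:C) *: L) <= e / complex.Re r.
Proof.
move=> r0 dw fe; set a := complex.Re r in r0 *.
have e0 : 0 <= e by rewrite (le_trans _ (fe 0)) // nm_ge0.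
pose W t := cexp (- r * t%:C) *: w t.
have WE t : w t = cexp (r * t%:C) *: W t.
  by rewrite scalerA mulNr mulrC cexpN scale1r.
have dW t : hasD W t (cexp (- r * t%:C) *: f t).
  apply: hasD_eq; first exact: (hasD_Z (hasD_cexp (- r) t) (dw t)).
  by rewrite scalerDr addrA scalerA -scalerDl mulNr [r * _]mulrC addNr scale0r add0r.
have dpsi (t : R) : is_derive t 1 (fun s : R => - (e / a) * expR (- (a * s)))
    (e * expR (- (a * t))).
  have := is_derive_expRN a t => H; apply: is_derive_eq.
  by rewrite /GRing.scale /=; field; rewrite gt_eqF.
have HW s t : s <= t -> nm (W t - W s) <= e / a * expR (- (a * s)).
  move=> st.
  have := mean_value_ineq st (fun t _ => dW t) (fun t _ => dpsi t).
  have H u : s <= u <= t -> nm (cexp (- r * u%:C) *: f u) <= e * expR (- (a * u)).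
    move=> _; rewrite nmZ normc_cexp Re_mulC raddfN mulNr /= mulrC.
    by rewrite ler_wpM2r ?expR_ge0.
  move/(_ H) => /le_trans; apply.
  have : 0 <= e / a * expR (- (a * t)) by rewrite mulr_ge0 ?expR_ge0 // divr_ge0 // ltW.
  lra.
have [L LP] := exp_cauchy_lim r0 HW; exists L => t.
rewrite WE -scalerBr nmZ normc_cexp Re_mulC -/a.
rewrite (le_trans (ler_wpM2l (expR_ge0 _) (LP t))) // mulrCA -expRD subrr.
by rewrite expR0 mulr1.
Qed.

Lemma ode_asymptotics (r : R[i]) (w f : R -> X) (e : R) :
  complex.Re r != 0 -> (forall t, hasD w t (r *: w t + f t)) ->
  (forall t, nm (f t) <= e) ->
  exists L, forall t, nm (w t - cexp (r * t%:C) *: L) <= e / `|complex.Re r|.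
Proof.
move=> r0 dw fe; have [a0|a0] := ltP 0 (complex.Re r).
  by rewrite gtr0_norm //; exact: ode_asymptotics_gt0 dw fe.
have {r0}a0 : complex.Re r < 0 by rewrite lt_neqAle r0.
rewrite ltr0_norm // -raddfN /=.
have [||t|L LP] := @ode_asymptotics_gt0 (- r) (fun t => w (- t)) (fun t => - f (- t)) e.
- by rewrite raddfN /= oppr_gt0.
- move=> t; apply: hasD_eq; first exact: (hasD_comp_opp (dw (- t))).
  by rewrite opprD scaleNr.
- by rewrite nmN.
by exists L => t; have := LP (- t); rewrite opprK rmorphN /= mulrNN.
Qed.

(** The mean value inequality is applied to the weighted sum of the [w k] plus [Phi t] times [e]. At
    infinity the sum dies out, the [w k] being bounded, and [l] times [e] remains. With [e = 0] this
    bounds the sum at [0]; with a unit vector it measures the distance of the sum to a prescribed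
    multiple of [e]. *)
Lemma half_line_estimate (I : finType) (P : pred I) (c r : I -> R[i])
    (w : I -> R -> X) (f : R -> X) (B : I -> R) (e : X)
    (Phi phi psi psi' : R -> R) (l m : R) :
  (forall k, P k -> 0 < complex.Re (r k)) ->
  (forall k t, P k -> hasD (w k) t (r k *: w k t + f t)) ->
  (forall k t, P k -> nm (w k t) <= B k) ->
  (forall t : R, 0 <= t -> is_derive t 1 Phi (phi t)) -> Phi x @[x --> +oo] --> l ->
  (forall t : R, 0 <= t -> is_derive t 1 psi (psi' t)) -> psi x @[x --> +oo] --> m ->
  (forall t, 0 <= t ->
    nm ((\sum_(k | P k) c k * cexp (- r k * t%:C)) *: f t + (phi t)%:C *: e)
      <= psi' t) ->
  nm (\sum_(k | P k) c k *: w k 0 + (Phi 0 - l)%:C *: e) <= m - psi 0.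
Proof.
move=> r0 dw wB dPhi Phil dpsi psim H.
pose F t := \sum_(k | P k) (c k * cexp (- r k * t%:C)) *: w k t + (Phi t)%:C *: e.
have dF t : 0 <= t -> hasD F t
    ((\sum_(k | P k) c k * cexp (- r k * t%:C)) *: f t + (phi t)%:C *: e).
  move=> t0; apply: hasD_D; last exact/hasD_Zl/hasD_real/dPhi.
  rewrite scaler_suml; apply: hasD_sum => k Pk.
  apply: hasD_ext.
    by move=> s; rewrite -scalerA; reflexivity.
  apply: hasD_eq.
    exact: (hasD_Zr (hasD_Z (hasD_cexp (- r k) t) (dw k t Pk))).
  rewrite [cexp _ *: (_ + _)]scalerDr addrA [_ *: (_ *: w k t)]scalerA.
  rewrite -scalerDl mulNr [r k * _]mulrC.
  by rewrite addNr scale0r add0r scalerA.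
(* The terms after [psi S - psi 0] bound the distance from [F S] to its limit and vanish as [S]
   grows. *)
pose h S := psi S - psi 0 +
  (\sum_(k | P k) Normc.normc (c k) * (expR (- (complex.Re (r k) * S)) * B k) +
   `|Phi S - l| * nm e).
have hl : h S @[S --> +oo] --> m - psi 0.
  have -> : m - psi 0 = m - psi 0 +
      (\sum_(k | P k) Normc.normc (c k) * (0 * B k) + `|l - l| * nm e).
    rewrite subrr normr0 mul0r addr0 big1 ?addr0 // => k _.
    by rewrite mul0r mulr0.
  apply: cvgD; first by apply: cvgB => //; exact: cvg_cst.
  apply: cvgD.
    apply: (@cvg_big _ _ _ _ _ add_continuous) => k Pk.
    apply: cvgM; first exact: cvg_cst.
    by apply: cvgM; [apply: cvg_expRN; exact: r0|exact: cvg_cst].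
  apply: cvgM; last exact: cvg_cst.
  by apply: cvg_norm; apply: cvgB => //; exact: cvg_cst.
apply: (cvgr_to_ge hl); near=> S.
have S0 : 0 <= S by near: S; exact: nbhs_pinfty_ge.
have := @mean_value_ineq R X F _ psi psi' 0 S S0
   (fun t tS => dF t (andP tS).1) (fun t tS => dpsi t (andP tS).1)
   (fun t tS => H t (andP tS).1).
move=> FS.
have -> : \sum_(k | P k) c k *: w k 0 + (Phi 0 - l)%:C *: e =
   - (F S - F 0) + (F S - l%:C *: e).
  rewrite opprB addrA subrK /F rmorphB scalerBl addrA; congr (_ + _ - _).
  by apply: eq_bigr => k _; rewrite mulr0 cexp0 mulr1.
rewrite (le_trans (ler_nmD _ _)) // nmN lerD // /F -addrA -scalerBl -rmorphB.
rewrite (le_trans (ler_nmD _ _)) // lerD //; last by rewrite nmZ normc_real.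
rewrite (le_trans (ler_nm_sum _ _)) // ler_sum // => k Pk.
rewrite -scalerA !nmZ ler_wpM2l ?normc_ge0 // normc_cexp Re_mulC raddfN mulNr /=.
by rewrite ler_wpM2l ?expR_ge0 // wB.
Unshelve. all: by end_near.
Qed.

End BoundedSolution.

(** * Lagrange interpolation at the roots *)

Section LagrangeBasis.
Context {F : fieldType} {n : nat} (r : 'I_n -> F).

Definition cofactor_poly (k : 'I_n) : {poly F} :=
  \prod_(j < n | j != k) ('X - (r j)%:P).

(** For [P] the product of all ['X - (r j)%:P], this is [1 / P'(r k)], the leading coefficient of
    the Lagrange basis polynomial at [r k]. *)
Definition lagrange_weight (k : 'I_n) : F := (cofactor_poly k).[r k]^-1.

Lemma cofactor_polyM k :
  ('X - (r k)%:P) * cofactor_poly k = \prod_(j < n) ('X - (r j)%:P).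
Proof. by rewrite [RHS](bigD1 k). Qed.

Lemma size_cofactor_poly k : size (cofactor_poly k) = n.
Proof.
rewrite /cofactor_poly -big_filter size_prod_XsubC -[X in _ = X](size_enum_ord n).
have := count_predC (pred1 k) (index_enum 'I_n).
rewrite count_uniq_mem ?index_enum_uniq // mem_index_enum add1n -size_filter.
by rewrite enumT.
Qed.

Lemma horner_cofactor_poly k j : j != k -> (cofactor_poly k).[r j] = 0.
Proof.
by move=> jk; rewrite horner_prod (bigD1 j) //= hornerXsubC subrr mul0r.
Qed.

Lemma horner_cofactor_polyE k :
  (cofactor_poly k).[r k] = \prod_(j < n | j != k) (r k - r j).
Proof. by rewrite horner_prod; apply: eq_bigr => j _; rewrite hornerXsubC. Qed.

Hypothesis r_inj : injective r.

Lemma horner_cofactor_neq0 k : (cofactor_poly k).[r k] != 0.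
Proof.
rewrite horner_cofactor_polyE; apply/prodf_neq0 => j jk.
by rewrite subr_eq0 inj_eq // eq_sym.
Qed.

Lemma lagrange_interpolation (p : {poly F}) : (size p <= n)%N ->
  p = \sum_(k < n) (p.[r k] * lagrange_weight k) *: cofactor_poly k.
Proof.
move=> pn; apply/eqP; rewrite -subr_eq0; apply/eqP.
apply: (@roots_geq_poly_eq0 _ _ [seq r k | k <- enum 'I_n]).
- apply/allP => _ /mapP[k _ ->]; rewrite rootE hornerD hornerN horner_sum.
  rewrite (bigD1 k) //= big1 => [|j jk]; last first.
    by rewrite hornerZ horner_cofactor_poly ?mulr0 // eq_sym.
  by rewrite hornerZ divfK ?horner_cofactor_neq0 // addr0 subrr.
- by rewrite map_inj_uniq // enum_uniq.
rewrite size_map size_enum_ord (leq_trans (size_polyD _ _)) // geq_max pn.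
rewrite size_polyN (leq_trans (size_sum _ _ _)) //; apply/bigmax_leqP => k _.
by rewrite (leq_trans (size_scale_leq _ _)) // size_cofactor_poly.
Qed.

(** Compare the coefficients of degree [n - 1] in the interpolation of ['X^m]: every [cofactor_poly]
    is monic of that degree. These moments decide when the forcing term enters the derivatives of a
    solution. *)
Lemma lagrange_weight_moment m : (m < n)%N ->
  \sum_(k < n) lagrange_weight k * r k ^+ m = (m == n.-1)%:R.
Proof.
move=> mn; have /lagrange_interpolation/(congr1 (fun p : {poly F} => p`_n.-1)) :
  (size ('X^m : {poly F}) <= n)%N by rewrite size_polyXn.
rewrite coefXn eq_sym => ->; rewrite coef_sum; apply: eq_bigr => k _.
rewrite coefZ hornerXn [cofactor_poly k]lock.
have : cofactor_poly k \is monic by apply: monic_prod => j _; exact: monicXsubC.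
by rewrite monicE /lead_coef size_cofactor_poly -lock => /eqP ->; rewrite mulr1 mulrC.
Qed.

End LagrangeBasis.

(** * Vandermonde determinants with one entry removed *)

Section Vandermonde.
Context {R : realType}.
Implicit Types (s : seq R[i]) (x : R[i]).

Lemma vandermonde_cons x s :
  vandermonde (x :: s) = \prod_(y <- s) (y - x) * vandermonde s.
Proof.
rewrite /vandermonde big_ord_recl /=; congr (_ * _).
  rewrite big_mkcond big_ord_recl /= mul1r (big_nth 0) big_mkord.
  by apply: eq_bigr.
apply: eq_bigr => i _; rewrite big_mkcond big_ord_recl /= mul1r [RHS]big_mkcond.
by apply: eq_bigr => j _.
Qed.

Lemma vandermonde_neq0 s : uniq s -> vandermonde s != 0.
Proof.
elim: s => [|x s IH]; first by rewrite /vandermonde big_ord0 oner_neq0.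
rewrite vandermonde_cons /= => /andP[xs us]; rewrite mulf_neq0 ?IH //.
rewrite prodf_seq_neq0; apply/allP => y ys /=; rewrite subr_eq0.
by apply: contraNneq xs => <-.
Qed.

(** Each entry after [x] contributes [y - x] instead of [x - y], hence one sign per entry of
    [s2]. *)
Lemma vandermonde_rem s1 x s2 :
  vandermonde (s1 ++ x :: s2) =
  (-1) ^+ size s2 * \prod_(y <- s1 ++ s2) (x - y) * vandermonde (s1 ++ s2).
Proof.
elim: s1 => [|z s1 IH] /=.
  rewrite vandermonde_cons; congr (_ * _).
  elim: s2 => [|y s2 IH]; first by rewrite !big_nil mulr1.
  by rewrite !big_cons IH /= exprS; ring.
rewrite !vandermonde_cons IH big_cons !big_cat big_cons /=; ring.
Qed.

(** Exactly [n - k.+1] indices follow [k] in the enumeration of ['I_n], which gives the sign. *)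
Lemma Vand_delE n (r : 'I_n -> R[i]) (k : 'I_n) :
  Vand r = (-1) ^+ (n - k.+1) * (cofactor_poly r k).[r k] * Vand_del r k.
Proof.
have [s1 [s2 E]] : exists s1 s2 : seq 'I_n, enum 'I_n = s1 ++ k :: s2.
  have : k \in enum 'I_n by rewrite mem_enum.
  by case/splitPr => s1 s2; exists s1, s2.
have U := enum_uniq 'I_n; rewrite E in U.
have ks : size s1 = k.
  have := index_enum_ord k; rewrite E index_cat /= eqxx addn0.
  move: U; rewrite cat_uniq /= => /and3P[_ /norP[ks _] _].
  by rewrite (negPf ks).
have ss : size s2 = (n - k.+1)%N.
  have := size_enum_ord n; rewrite E size_cat /= ks addnS -addSn => nE.
  by rewrite -[X in (X - _)%N]nE addKn.
have del : [seq i <- enum 'I_n | i != k] = s1 ++ s2.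
  rewrite E; move: U; rewrite cat_uniq /= => /and4P[_ /norP[k1 _] k2 _].
  rewrite filter_cat /= eqxx /=; congr (_ ++ _); apply/all_filterP/allP => j js;
  by apply: contraTneq js => ->.
rewrite /Vand /Vand_del del E !map_cat /= vandermonde_rem size_map ss.
congr (_ * _ * _); rewrite horner_cofactor_polyE -map_cat big_map -del big_filter.
by rewrite enumT.
Qed.

End Vandermonde.

(** * Factorisation of the characteristic polynomial *)

Section CharacteristicPolynomial.
Context {R : realType} {n : nat} (a r : 'I_n -> R[i]).
Hypothesis r_inj : injective r.
Hypothesis r_root : forall k, root (charpoly a) (r k).

Lemma charpoly_prod : charpoly a = \prod_(k < n) ('X - (r k)%:P).
Proof.
have sl : (size (\sum_(i < n) (a i)%:P * 'X^(n - i.+1))%R <= n)%N.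
  rewrite (leq_trans (size_sum _ _ _)) //; apply/bigmax_leqP => i _.
  rewrite mul_polyC (leq_trans (size_scale_leq _ _)) // size_polyXn.
  by rewrite -subSn // subSS leq_subr.
have sc : size (charpoly a) = n.+1.
  by rewrite size_polyDl size_polyXn // ltnS.
have lc : lead_coef (charpoly a) = 1.
  by rewrite lead_coefDl ?lead_coefXn ?size_polyXn ?ltnS.
rewrite -(big_enum _ _ 'I_n) /= -(big_map r predT (fun x => 'X - x%:P)).
rewrite [LHS](@all_roots_prod_XsubC _ _ [seq r k | k <- enum 'I_n]).
- by rewrite lc scale1r.
- by rewrite size_map size_enum_ord.
- by apply/allP => _ /mapP[k _ ->].
by rewrite uniq_rootsE map_inj_uniq // enum_uniq.
Qed.

End CharacteristicPolynomial.

(** * The operator as a polynomial in the derivative *)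

Section DifferentialOperator.
Context {R : realType} {X : completeNormedModType R[i]}.

Lemma hasD_derivX (f : R -> X) t l : hasD f t l -> Defs.derivX f t = l.
Proof. exact: cvg_lim. Qed.

Lemma hasD_derivableX (f : R -> X) t l : hasD f t l -> Defs.derivableX f t.
Proof. by move=> fl; apply/cvg_ex; exists l. Qed.

Lemma derivableX_hasD (f : R -> X) t : Defs.derivableX f t -> hasD f t (Defs.derivX f t).
Proof. by []. Qed.

(** This is [q (d/dt)] cut at order [n], so it is the full operator only for [q] of degree at most
    [n]. *)
Definition polyD (n : nat) (q : {poly R[i]}) (y : R -> X) (t : R) : X :=
  \sum_(i < n.+1) q`_i *: derivnX i y t.

Section PolyD.
Context {n : nat}.
Implicit Types (p q : {poly R[i]}) (y : R -> X) (t : R).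

Lemma polyD_add p q y t : polyD n (p + q) y t = polyD n p y t + polyD n q y t.
Proof.
by rewrite -big_split; apply: eq_bigr => i _; rewrite coefD scalerDl.
Qed.

Lemma polyD_scale c q y t : polyD n (c *: q) y t = c *: polyD n q y t.
Proof.
by rewrite scaler_sumr; apply: eq_bigr => i _; rewrite coefZ scalerA.
Qed.

Lemma polyD_sum (I : finType) (F : I -> {poly R[i]}) y t :
  polyD n (\sum_i F i) y t = \sum_i polyD n (F i) y t.
Proof.
rewrite exchange_big; apply: eq_bigr => i _.
by rewrite coef_sum scaler_suml.
Qed.

Lemma polyD_Xn k y t : (k <= n)%N -> polyD n 'X^k y t = derivnX k y t.
Proof.
move=> kn; have k' : (k < n.+1)%N by [].
rewrite /polyD (bigD1 (Ordinal k')) //= coefXn eqxx scale1r big1 ?addr0 // => i.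
by rewrite -val_eqE /= coefXn => /negPf ->; rewrite scale0r.
Qed.

Lemma Lop_polyD (a : 'I_n -> R[i]) y t : Lop a y t = polyD n (charpoly a) y t.
Proof.
rewrite polyD_add polyD_Xn // polyD_sum; congr (_ + _); apply: eq_bigr => i _.
by rewrite mul_polyC polyD_scale polyD_Xn // leq_subr.
Qed.

(** Multiplication by ['X] is differentiation. The size bound keeps the [n]-th derivative of [y],
    only known to be continuous, out of the differentiated sum. *)
Lemma hasD_polyD q y t : Cn n y -> (size q <= n)%N ->
  hasD (polyD n q y) t (polyD n ('X * q) y t).
Proof.
move=> [dy _] qn.
have -> : polyD n ('X * q) y t = \sum_(i < n) q`_i *: derivnX i.+1 y t.
  rewrite /polyD big_ord_recl coefXM eqxx scale0r add0r.
  by apply: eq_bigr => i _; rewrite coefXM.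
apply: (hasD_ext (f := fun s => \sum_(i < n) q`_i *: derivnX i y s)).
  by move=> s; rewrite /polyD big_ord_recr /= (nth_default _ qn) scale0r addr0.
by apply: hasD_sum => i _; apply: hasD_Zr; apply: derivableX_hasD; exact: dy.
Qed.

End PolyD.

Section Solutions.
Context {n : nat} (a r : 'I_n -> R[i]).
Hypothesis n_gt0 : (0 < n)%N.
Hypothesis r_inj : injective r.
Hypothesis r_root : forall k, root (charpoly a) (r k).

Lemma Cn_decomposition (y : R -> X) : Cn n y ->
  exists w : 'I_n -> R -> X,
    (forall k t, hasD (w k) t (r k *: w k t + Lop a y t)) /\
    (forall t, y t = \sum_(k < n) lagrange_weight r k *: w k t).
Proof.
move=> yn; exists (fun k => polyD n (cofactor_poly r k) y); split=> [k t|t].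
  apply: hasD_eq; first by apply: hasD_polyD; rewrite ?size_cofactor_poly.
  rewrite Lop_polyD (charpoly_prod r_inj r_root) -(cofactor_polyM r k) mulrBl.
  by rewrite -scaleN1r polyD_add polyD_scale mul_polyC polyD_scale scaleN1r addrC subrK.
(* Interpolating the constant [1] expresses the identity operator through the cofactors. *)
have E := @lagrange_interpolation _ _ _ r_inj 1; rewrite size_poly1 in E.
have -> : y t = polyD n 1 y t by rewrite -(expr0 'X) polyD_Xn.
rewrite E // polyD_sum; apply: eq_bigr => k _.
by rewrite polyD_scale hornerC mul1r.
Qed.

Variables (w : 'I_n -> R -> X) (f : R -> X).
Hypothesis dw : forall k t, hasD (w k) t (r k *: w k t + f t).
Let c := lagrange_weight r.
Let y t := \sum_(k < n) c k *: w k t.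

(** Each differentiation brings out a moment of the weights in front of [f]. By
    [lagrange_weight_moment] it is zero before the [n]-th differentiation, where it is one. *)
Let dstep m t : hasD (fun s => \sum_(k < n) (c k * r k ^+ m) *: w k s) t
  (\sum_(k < n) (c k * r k ^+ m.+1) *: w k t
   + (\sum_(k < n) c k * r k ^+ m) *: f t).
Proof.
apply: hasD_eq.
  by apply: hasD_sum => k _; apply: hasD_Zr; exact: dw.
rewrite scaler_suml -big_split; apply: eq_bigr => k _.
by rewrite scalerDr scalerA exprSr mulrA.
Qed.

Let derivn_y m : (m < n)%N ->
  derivnX m y = fun t => \sum_(k < n) (c k * r k ^+ m) *: w k t.
Proof.
elim: m => [|m IH] mn; apply/funext => t.
  by apply: eq_bigr => k _; rewrite expr0 mulr1.
rewrite /derivnX iterS -/(derivnX m y) IH ?(ltnW mn) //.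
rewrite (hasD_derivX (@dstep m t)) lagrange_weight_moment ?(ltnW mn) //.
by rewrite ltn_eqF ?scale0r ?addr0 // -ltnS prednK.
Qed.

Let derivn_n : derivnX n y =
  fun t => \sum_(k < n) (c k * r k ^+ n) *: w k t + f t.
Proof.
apply/funext => t; rewrite -[X in derivnX X y](prednK n_gt0) /derivnX iterS.
rewrite -/(derivnX n.-1 y) derivn_y ?prednK // (hasD_derivX (@dstep n.-1 t)).
by rewrite lagrange_weight_moment // ?eqxx ?scale1r prednK.
Qed.

Lemma Cn_solution : (forall t, f s @[s --> t] --> f t) -> Cn n y.
Proof.
move=> cf; split=> [m mn t|t].
  by rewrite derivn_y //; apply: hasD_derivableX; exact: dstep.
rewrite derivn_n; apply: cvgD; last exact: cf.
exact: hasD_cvg (@dstep n t).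
Qed.

(** Each [r k] is a root of [charpoly a], so the coefficient of every [w k] cancels, and the [f] in
    the [n]-th derivative is all that is left. *)
Lemma Lop_solution t : Lop a y t = f t.
Proof.
have E : \sum_(k < n) (c k * (charpoly a).[r k]) *: w k t = 0.
  by apply: big1 => k _; rewrite (rootP (r_root k)) mulr0 scale0r.
rewrite /Lop derivn_n addrAC -[RHS]add0r; congr (_ + _); apply: etrans E.
have -> : \sum_(i < n) a i *: derivnX (n - i.+1) y t =
    \sum_(i < n) \sum_(k < n) (a i * (c k * r k ^+ (n - i.+1))) *: w k t.
  apply: eq_bigr => i _; rewrite derivn_y; last by rewrite -subSn // subSS leq_subr.
  by rewrite scaler_sumr; apply: eq_bigr => k _; rewrite scalerA.
rewrite exchange_big -big_split; apply: eq_bigr => k _.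
rewrite /= -scaler_suml -scalerDl hornerD horner_sum hornerXn mulrDr mulr_sumr.
congr (_ *: _); congr (_ + _); apply: eq_bigr => i _.
by rewrite hornerM hornerC hornerXn mulrCA.
Qed.

End Solutions.

End DifferentialOperator.

(** * Primitives of continuous functions *)

Section Antiderivative.
Context {R : realType}.
Local Notation mu := (@lebesgue_measure R).

(** Integration starts at [-1] so that [0], where two primitives are glued below, is an interior
    point. *)
Lemma antiderivative_gtN1 (h : R -> R) : continuous h ->
  exists H : R -> R, H 0 = 0 /\ forall t : R, -1 < t -> is_derive t 1 H (h t).
Proof.
move=> ch; pose F x := (\int[mu]_(t in `[-1, x]) h t)%R.
exists (F - cst (F 0)); split; first by rewrite /= /cst /GRing.add /= subrr.
move=> t t1; have [] := @continuous_FTC1_closed R h (-1) t (t + 1).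
- by rewrite ltrDl.
- apply: continuous_compact_integrable; first exact: segment_compact.
  exact: continuous_subspaceT.
- exact: t1.
- exact: ch.
rewrite -/F => dF Ft; have H : is_derive t 1 F (h t).
  by rewrite -Ft derive1E; exact: derivableP.
by apply: is_derive_eq; rewrite subr0.
Qed.

(** A primitive to the right of [-1] and a reflected one to the left of [1] are glued at [0], where
    they agree in value and derivative; there the gluing is done on the slope functions of the
    Caratheodory criterion. *)
Lemma continuous_antiderivative (h : R -> R) : continuous h ->
  exists H : R -> R, H 0 = 0 /\ forall t : R, is_derive t 1 H (h t).
Proof.
move=> ch; have [P [P0 dP]] := antiderivative_gtN1 ch.
have [|Q [Q0 dQ]] := @antiderivative_gtN1 (fun t => - h (- t)).
  move=> t; apply: cvgN; apply: continuous_comp; last exact: ch.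
  exact: opp_continuous.
pose Q' t := Q (- t).
have {}dQ (t : R) : t < 1 -> is_derive t 1 Q' (h t).
  move=> t1; have HQ : is_derive (- t) 1 Q (- h t).
    by have := dQ (- t); rewrite opprK; apply; rewrite ltrN2.
  have : is_derive t 1 (Q \o -%R) (-1 * - h t) by apply: is_derive_eq; rewrite mulrC.
  by rewrite mulN1r opprK.
exists (fun t => if 0 <= t then P t else Q' t); split; first by rewrite lexx.
move=> t; have [t0|t0|->] := ltgtP t 0.
- apply: near_eq_is_derive (dQ t _); last exact: lt_trans t0 ltr01.
  near=> s; have s0 : s < 0 by near: s; exact: lt_nbhsl.
  by rewrite leNgt s0.
- apply: near_eq_is_derive (dP t _); last exact: lt_trans (ltrN10 R) t0.
  near=> s; have -> // : 0 <= s.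
  by near: s; exact: lt_le_nbhsr.
apply/is_derive1_caratheodory.
have [|g1 [E1 c1 g10]] := (is_derive1_caratheodory P 0 (h 0)).1.
  by apply: dP; exact: ltrN10.
have [|g2 [E2 c2 g20]] := (is_derive1_caratheodory Q' 0 (h 0)).1.
  by apply: dQ.
exists (fun z => if 0 <= z then g1 z else g2 z); split; last by rewrite lexx.
  move=> z; rewrite lexx; case: ifP => _; first by rewrite E1.
  by rewrite -E2 P0 /Q' oppr0 Q0 oppr0.
apply/cvgrPdist_le => e e0; rewrite lexx.
move/cvgrPdist_le : c1 => /(_ e e0); move/cvgrPdist_le : c2 => /(_ e e0).
rewrite g10 g20; apply: filterS2 => z; by case: ifP.
Unshelve. all: by end_near.
Qed.

Lemma cvg_nm {V : normedModType R[i]} {T : Type} (F : set_system T) (FF : Filter F)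
  (f : T -> V) (l : V) : f x @[x --> F] --> l -> nm (f x) @[x --> F] --> nm l.
Proof.
move=> /cvgNmP fl; apply/cvgrPdist_le => e /fl; apply: filterS => x.
by apply: le_trans; rewrite ler_norml lerNl opprB ler_nm_dist nm_distC ler_nm_dist.
Qed.

(** * Integrals of norms of sums of decaying exponentials *)

Section ExponentialSum.
Context {I : finType} (P : pred I) (c r : I -> R[i]).
Hypothesis Re_r : forall k, P k -> 0 < complex.Re (r k).

Definition expsum (t : R) : R[i]^o := \sum_(k | P k) c k * cexp (- r k * t%:C).

Lemma expsum_continuous t : expsum s @[s --> t] --> expsum t.
Proof.
apply: hasD_cvg; apply: hasD_sum => k _.
exact: (hasD_Zr (c := c k) (hasD_cexp (- r k) t)).
Qed.

Lemma le_nm_expsum (t : R) :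
  nm (expsum t) <= \sum_(k | P k) Normc.normc (c k) * expR (- (complex.Re (r k) * t)).
Proof.
rewrite (le_trans (ler_nm_sum _ _)) // ler_sum // => k _.
by rewrite nm_normc Normc.normcM normc_cexp Re_mulC raddfN mulNr.
Qed.

(** The primitive [Phi] of the norm is nondecreasing, and bounded by comparison with a primitive of
    the majorant in [le_nm_expsum]. It converges to its supremum, which the fundamental theorem of
    calculus identifies with the integral. *)
Lemma expsum_norm_integral : exists (Phi : R -> R) (l : R),
  [/\ Phi 0 = 0, (forall t : R, is_derive t 1 Phi (nm (expsum t))),
      Phi x @[x --> +oo] --> l &
      (\int[mu]_(x in `[0%R, +oo[) (nm (expsum x))%:E = l%:E)%E].
Proof.
have cphi : continuous (fun t => nm (expsum t)).
  by move=> t; apply: cvg_nm; exact: expsum_continuous.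
have [Phi [Phi0 dPhi]] := continuous_antiderivative cphi.
(* This primitive of the majorant is nonpositive, so its increase from [0] is at most [- psi 0]. *)
pose psi (t : R) := \sum_(k | P k)
  - (Normc.normc (c k) / complex.Re (r k)) * expR (- (complex.Re (r k) * t)).
have dpsi (t : R) : is_derive t 1 psi
    (\sum_(k | P k) Normc.normc (c k) * expR (- (complex.Re (r k) * t))).
  rewrite /psi; elim: (index_enum I) => [|k s IH].
    under eq_fun do rewrite big_nil; rewrite big_nil; exact: is_derive_cst.
  under eq_fun do rewrite big_cons; rewrite big_cons; case: ifPn => // Pk.
  have H := is_derive_expRN (complex.Re (r k)) t.
  apply: is_derive_eq; congr (_ + _).
  by rewrite /GRing.scale /=; field; rewrite gt_eqF // Re_r.
have psi_le0 t : psi t <= 0.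
  rewrite sumr_le0 // => k Pk.
  by rewrite mulNr oppr_le0 mulr_ge0 ?expR_ge0 // divr_ge0 ?normc_ge0 // ltW // Re_r.
have incr s t : s <= t -> Phi s <= Phi t.
  move=> st; rewrite -subr_ge0.
  have := @mean_value_ineq R R[i]^o (fun=> 0) (fun=> 0) _ _ _ _ st
    (fun u _ => hasD_cst (V := R[i]^o) _ _) (fun u _ => dPhi u).
  by rewrite subrr nm0; apply => u _; exact: nm_ge0.
have ub t : Phi t <= - psi 0.
  apply: (@le_trans _ _ (Phi (Num.max t 0))); first by rewrite incr // le_max lexx.
  have t0 : 0 <= Num.max t 0 by rewrite le_max lexx orbT.
  have := @mean_value_ineq R R[i]^o (fun s => (Phi s)%:C) _ _ _ _ _ t0
    (fun u _ => hasD_real (dPhi u)) (fun u _ => dpsi u).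
  rewrite -rmorphB nm_real Phi0 subr0 => H.
  apply: le_trans (ler_norm _) (le_trans (H _) _) => [u _|].
    by rewrite nm_real ger0_norm ?nm_ge0 // le_nm_expsum.
  by rewrite gerDr psi_le0.
have Phil : Phi x @[x --> +oo] --> sup (range Phi).
  by apply: nondecreasing_cvgr => //; exists (- psi 0) => _ [t _ <-].
exists Phi, (sup (range Phi)); split => //.
rewrite (ge0_continuous_FTC2y (F := Phi) (l := sup (range Phi))) ?Phi0 ?sube0 //.
- by move=> x _; exact: nm_ge0.
- exact: continuous_subspaceT.
- apply: cvg_at_right_filter; rewrite -[X in _ --> X]Phi0.
  apply: differentiable_continuous; apply/derivable1_diffP; by have [] := dPhi 0.
by move=> x _; rewrite derive1E; have [] := dPhi x.
Qed.

End ExponentialSum.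

End Antiderivative.

(** * Bounded sums of exponentials vanish *)

Section BoundedExponentialSum.
Context {R : realType} {X : completeNormedModType R[i]} {n : nat}.
Variables (r : 'I_n -> R[i]) (u : 'I_n -> X).
Hypothesis r_inj : injective r.

(** Exponentials with distinct exponents can still coincide at some times. Near [0], however, their
    difference has slope [r k - r j], so every small nonzero [h] works for all [j] at once. *)
Lemma cexp_separates (k : 'I_n) : exists h : R,
  forall j, j != k -> cexp (r k * h%:C) != cexp (r j * h%:C).
Proof.
have : \forall h \near (0 : R)^', forall j, j != k ->
    cexp (r k * h%:C) != cexp (r j * h%:C).
  apply: filter_forall => j; have [->|jk] := eqVneq j k.
    by apply: filterE.
  have rjk : 0 < Normc.normc (r k - r j).
    rewrite lt_neqAle normc_ge0 andbT eq_sym; apply/eqP => /Normc.eq0_normc /eqP.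
    by rewrite subr_eq0 inj_eq // eq_sym (negPf jk).
  have := hasD_B (hasD_cexp (r k) 0) (hasD_cexp (r j) 0).
  rewrite !mulr0 cexp0 !mulr1 => /hasDP.
  have e0 : 0 < Normc.normc (r k - r j) / 2 by rewrite divr_gt0.
  move=> /(_ _ e0)[d d0 dP]; rewrite near_withinE; apply/nbhs_ballP; exists d => // h.
  rewrite /ball /= sub0r normrN => /dP + h0 _; apply: contraTneq.
  rewrite add0r => ->; rewrite !mulr0 cexp0 !subrr sub0r nmN nmZ normc_real.
  rewrite -ltNge mulrC ltr_pM2l ?normr_gt0 //.
  by rewrite ltr_pdivrMr // mulrDr mulr1 ltrDl.
by move=> /filter_ex[h hP]; exists h.
Qed.

(** Translates of the sum by multiples of [h], combined with the coefficients of a polynomial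
    vanishing at [E j] for [j != k], isolate the [k]-th term. That term is then bounded on the whole
    line, which its nonzero growth rate permits only if [u k = 0]. *)
Lemma bounded_expsum_eq0 (B : R) : (forall k, complex.Re (r k) != 0) ->
  (forall t : R, nm (\sum_(k < n) cexp (r k * t%:C) *: u k) <= B) ->
  forall k, u k = 0.
Proof.
move=> r0 uB k; have [h hP] := cexp_separates k.
pose E j := cexp (r j * h%:C); pose q := cofactor_poly E k.
have qE j : j != k -> q.[E j] = 0 by move=> jk; exact: horner_cofactor_poly.
have qk : q.[E k] != 0.
  rewrite horner_cofactor_polyE; apply/prodf_neq0 => j jk.
  by rewrite subr_eq0 hP.
pose z (t : R) := \sum_(k < n) cexp (r k * t%:C) *: u k.
have zq (t : R) : \sum_(i < size q) q`_i *: z (t + i%:R * h) =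
    (q.[E k] * cexp (r k * t%:C)) *: u k.
  transitivity (\sum_(j < n) (q.[E j] * cexp (r j * t%:C)) *: u j).
    under eq_bigr do rewrite scaler_sumr.
    rewrite exchange_big; apply: eq_bigr => j _ /=.
    rewrite horner_coef mulr_suml scaler_suml; apply: eq_bigr => i _.
    rewrite scalerA; congr (_ *: _); rewrite -mulrA; congr (_ * _).
    rewrite rmorphD /= mulrDr cexpD mulrC; congr (_ * _).
    rewrite /E rmorphM /= rmorph_nat; elim: (i : nat) => [|m IH].
      by rewrite mul0r mulr0 cexp0 expr0.
    by rewrite exprS -IH -cexpD; congr cexp; rewrite -natr1; ring.
  by rewrite (bigD1 k) //= big1 ?addr0 // => j jk; rewrite qE // mul0r scale0r.
pose M := \sum_(i < size q) Normc.normc q`_i * B.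
have bound (t : R) : Normc.normc q.[E k] * (expR (complex.Re (r k) * t) * nm (u k)) <= M.
  rewrite -Re_mulC -normc_cexp -!nmZ scalerA -zq.
  rewrite (le_trans (ler_nm_sum _ _)) // ler_sum // => i _.
  by rewrite nmZ ler_wpM2l ?normc_ge0 // uB.
apply: nm_eq0; rewrite leNgt; apply/negP => uk0.
have q0 : 0 < Normc.normc q.[E k].
  by rewrite lt_neqAle normc_ge0 andbT eq_sym; apply: contra_neq qk => /Normc.eq0_normc.
have C0 : 0 < Normc.normc q.[E k] * nm (u k) by rewrite mulr_gt0.
(* At time [s / complex.Re (r k)] the exponential has modulus [expR s], at least [1 + s], while
   [bound] allows at most [s]. *)
pose s := M / (Normc.normc q.[E k] * nm (u k)).
have := bound (s / complex.Re (r k)); rewrite [complex.Re _ * _]mulrC divfK ?r0 //.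
rewrite mulrCA -ler_pdivlMr // -/s leNgt => /negP; apply.
by rewrite (lt_le_trans _ (expR_ge1Dx _)) // ltrDr.
Qed.

End BoundedExponentialSum.

(** * Continuous approximation of a phase *)

Section Extremizer.
Context {R : realType}.

Lemma cvg_real_complex {T : Type} (F : set_system T) (FF : Filter F)
  (f : T -> R) (l : R) : f x @[x --> F] --> l ->
  ((f x)%:C : R[i]^o) @[x --> F] --> (l%:C : R[i]^o).
Proof.
move=> fl; apply/cvgNmP => e e0; move/cvgrPdist_le : fl => /(_ e e0).
by apply: filterS => x; rewrite -rmorphB nm_real distrC.
Qed.

Lemma Re_le_nm (z : R[i]^o) : `|complex.Re z| <= nm z.
Proof. by rewrite -lecR -nmE normc_ge_Re. Qed.

Lemma Im_le_nm (z : R[i]^o) : `|complex.Im z| <= nm z.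
Proof.
by rewrite nm_normc; case: z => x y /=; rewrite -sqrtr_sqr ler_wsqrtr // lerDr sqr_ge0.
Qed.

Lemma cvg_Re {T : Type} (F : set_system T) (FF : Filter F)
  (f : T -> R[i]^o) (l : R[i]^o) : f x @[x --> F] --> l ->
  complex.Re (f x) @[x --> F] --> complex.Re l.
Proof.
move=> /cvgNmP fl; apply/cvgrPdist_le => e /fl; apply: filterS => x.
by apply: le_trans; rewrite distrC -raddfB Re_le_nm.
Qed.

Lemma cvg_Im {T : Type} (F : set_system T) (FF : Filter F)
  (f : T -> R[i]^o) (l : R[i]^o) : f x @[x --> F] --> l ->
  complex.Im (f x) @[x --> F] --> complex.Im l.
Proof.
move=> /cvgNmP fl; apply/cvgrPdist_le => e /fl; apply: filterS => x.
by apply: le_trans; rewrite distrC -raddfB Im_le_nm.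
Qed.

Lemma nm_conj (z : R[i]^o) : nm (conjc z : R[i]^o) = nm z.
Proof. by rewrite !nm_normc; case: z => x y /=; rewrite sqrrN. Qed.

Lemma cvg_conj {T : Type} (F : set_system T) (FF : Filter F)
  (f : T -> R[i]^o) (l : R[i]^o) : f x @[x --> F] --> l ->
  (conjc (f x) : R[i]^o) @[x --> F] --> (conjc l : R[i]^o).
Proof.
move=> /cvgNmP fl; apply/cvgNmP => e /fl; apply: filterS => x.
by rewrite -rmorphB /= nm_conj.
Qed.

Lemma mulr_conjc (z : R[i]) : z * conjc z = ((Normc.normc z) ^+ 2)%:C.
Proof.
case: z => x y; rewrite /= sqr_sqrtr ?addr_ge0 ?sqr_ge0 //.
by apply/eqP; rewrite eq_complex /=; apply/andP; split; apply/eqP; ring.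
Qed.

Lemma complex_antiderivative (h : R -> R[i]^o) :
  (forall t, h s @[s --> t] --> h t) ->
  exists H : R -> R[i]^o, forall t, hasD H t (h t).
Proof.
move=> ch.
have [|U [_ dU]] := @continuous_antiderivative R (fun t => complex.Re (h t)).
  by move=> t; apply: cvg_Re; exact: ch.
have [|W [_ dW]] := @continuous_antiderivative R (fun t => complex.Im (h t)).
  by move=> t; apply: cvg_Im; exact: ch.
exists (fun t => U t +i* W t) => t.
by apply: (hasD_eq (hasD_complex (dU t) (dW t))); case: (h t).
Qed.

(* A continuous substitute for the phase [conjc g / |g|], supported on the
   positive half-line so that the extremizers of both half-lines can be glued
   even though the Green kernel may jump at [0] (it does when [n = 1]). *)
Lemma approximate_phase (g : R -> R[i]^o) (d : R) : 0 < d ->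
  (forall t, g s @[s --> t] --> g t) ->
  exists p : R -> R[i]^o,
    [/\ (forall t, p s @[s --> t] --> p t), (forall t, t <= 0 -> p t = 0),
        (forall t, nm (p t) <= 1) &
        (forall t, 0 <= t -> nm (g t * p t - (nm (g t))%:C : R[i]^o) <=
           nm (g t) * expR (- (d^-1 * t)) + d * expR (- (1 * t)))].
Proof.
move=> d0 cg.
(* [theta] vanishes for [t <= 0] and tends to one exponentially at rate [1 / d]; [eta] keeps the
   denominator of [rho] positive where [g] vanishes. *)
pose theta t : R := 1 - expR (- (d^-1 * Num.max t 0)).
pose eta t : R := d * expR (- (1 * t)).
have eta0 t : 0 < eta t by rewrite mulr_gt0 ?expR_gt0.
have den0 t : 0 < nm (g t) + eta t by rewrite ltr_wpDl ?nm_ge0.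
have theta0 t : 0 <= theta t.
  rewrite subr_ge0 -expR0 ler_expR oppr_le0.
  by rewrite mulr_ge0 ?le_max ?lexx ?orbT // invr_ge0 ltW.
have theta1 t : theta t <= 1 by rewrite gerBl expR_ge0.
pose rho t := theta t / (nm (g t) + eta t).
have rho0 t : 0 <= rho t by rewrite divr_ge0 // ltW.
exists (fun t => (rho t)%:C *: (conjc (g t) : R[i]^o)); split.
- move=> t; apply: cvgZ; last by apply: cvg_conj; exact: cg.
  apply: cvg_real_complex; apply: cvgM.
    apply: cvgB; first exact: cvg_cst.
    apply: (cvg_comp (fun s => - (d^-1 * Num.max s 0)) expR _ (@continuous_expR R _)).
    apply: cvgN; apply: cvgM; first exact: cvg_cst.
    by apply: (@continuous_max R R id (cst 0)); [exact: cvg_id|exact: cvg_cst].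
  apply: cvgV; first by rewrite gt_eqF.
  apply: cvgD; first by apply: cvg_nm; exact: cg.
  apply: cvgM; first exact: cvg_cst.
  apply: (cvg_comp (fun s => - (1 * s)) expR _ (@continuous_expR R _)).
  by apply: cvgN; apply: cvgM; [exact: cvg_cst|exact: cvg_id].
- move=> t t0; rewrite /rho /theta (max_idPr t0) mulr0 oppr0 expR0 subrr mul0r.
  by rewrite scale0r.
- move=> t; rewrite nmZ normc_real nm_conj ger0_norm // /rho mulrAC.
  rewrite ler_pdivrMr // mul1r.
  have := nm_ge0 (g t); have := theta1 t; have := theta0 t; have := eta0 t; nra.
move=> t t0.
have -> : g t * ((rho t)%:C *: (conjc (g t) : R[i]^o)) - (nm (g t))%:C =
    (rho t * nm (g t) ^+ 2 - nm (g t))%:C.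
  rewrite rmorphB; congr (_ - _); rewrite mulrCA mulr_conjc.
  exact/esym/rmorphM.
rewrite nm_real distrC.
(* The deficit is the announced bound times [nm (g t) / (nm (g t) + eta t)], a factor at most
   one. *)
have E : nm (g t) - rho t * nm (g t) ^+ 2 =
    nm (g t) * (nm (g t) * (1 - theta t) + eta t) / (nm (g t) + eta t).
  rewrite /rho; move: (nm (g t)) (theta t) (eta t) (den0 t) => G T E E0.
  by field; rewrite gt_eqF.
have G0 : 0 <= nm (g t) * (1 - theta t) + eta t.
  by rewrite addr_ge0 ?mulr_ge0 ?nm_ge0 ?subr_ge0 // ltW.
rewrite E ger0_norm; last by rewrite divr_ge0 ?mulr_ge0 ?nm_ge0 // ltW.
rewrite ler_pdivrMr //.
have -> : nm (g t) * expR (- (d^-1 * t)) + d * expR (- (1 * t)) =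
    nm (g t) * (1 - theta t) + eta t.
  by rewrite /theta (max_idPl t0) subKr.
by rewrite mulrC ler_wpM2l // lerDl ltW.
Qed.

End Extremizer.

(** * The norm of the Green kernel is the best Ulam constant *)

Section BestConstant.
Context {R : realType} {X : completeNormedModType R[i]} {n : nat}.
Variables (a r : 'I_n -> R[i]).
Hypothesis n_gt0 : (0 < n)%N.
Hypothesis r_inj : injective r.
Hypothesis r_root : forall k, root (charpoly a) (r k).
Hypothesis Re_r : forall k, complex.Re (r k) != 0.

Let c := lagrange_weight r.
Let pos : pred 'I_n := fun k => 0 < complex.Re (r k).
Let neg : pred 'I_n := fun k => complex.Re (r k) < 0.
(** Up to sign, [gp] and [gm] are the two halves of the bounded Green kernel of the operator, each
    written so that it decays at [+oo]. *)
Let gp := expsum pos c r.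
Let gm := expsum neg c (fun k => - r k).

Variables (Phip Phim : R -> R) (lp lm : R).
Hypotheses (Phip0 : Phip 0 = 0) (Phim0 : Phim 0 = 0).
Hypothesis dPhip : forall t : R, is_derive t 1 Phip (nm (gp t)).
Hypothesis dPhim : forall t : R, is_derive t 1 Phim (nm (gm t)).
Hypothesis Phip_lim : Phip x @[x --> +oo] --> lp.
Hypothesis Phim_lim : Phim x @[x --> +oo] --> lm.

Let sum_pos_neg (F : 'I_n -> X) :
  \sum_k F k = \sum_(k | pos k) F k + \sum_(k | neg k) F k.
Proof.
rewrite (bigID pos) /=; congr (_ + _); apply: eq_bigl => k.
by rewrite /pos /neg -leNgt le_eqVlt (negPf (Re_r k)).
Qed.

(** One half-line estimate for each sign of the real parts, the negative ones after time reversal,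
    which turns [f] into [- f (- t)]. *)
Let half_lines (w : 'I_n -> R -> X) (f : R -> X) (B : 'I_n -> R) (e : X)
    (psip psip' psim psim' : R -> R) (mp mm : R) :
  (forall k t, hasD (w k) t (r k *: w k t + f t)) ->
  (forall k t, nm (w k t) <= B k) ->
  (forall t : R, 0 <= t -> is_derive t 1 psip (psip' t)) ->
  psip x @[x --> +oo] --> mp ->
  (forall t : R, 0 <= t -> is_derive t 1 psim (psim' t)) ->
  psim x @[x --> +oo] --> mm ->
  (forall t, 0 <= t -> nm (gp t *: f t + (nm (gp t))%:C *: e) <= psip' t) ->
  (forall t, 0 <= t -> nm (gm t *: - f (- t) + (nm (gm t))%:C *: e) <= psim' t) ->
  nm (\sum_k c k *: w k 0 - (lp + lm)%:C *: e) <= (mp - psip 0) + (mm - psim 0).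
Proof.
move=> dw wB dpp lpp dpm lpm Hp Hm.
have Ep := @half_line_estimate R X _ pos c r w f B e Phip _ psip psip' lp mp
  (fun k Pk => Pk) (fun k t _ => dw k t) (fun k t _ => wB k t)
  (fun t _ => dPhip t) Phip_lim dpp lpp Hp.
have Em := @half_line_estimate R X _ neg c (fun k => - r k) (fun k t => w k (- t))
  (fun t => - f (- t)) B e Phim _ psim psim' lm mm.
rewrite oppr0 Phim0 in Em; rewrite Phip0 in Ep.
have -> : \sum_k c k *: w k 0 - (lp + lm)%:C *: e =
    (\sum_(k | pos k) c k *: w k 0 + (0 - lp)%:C *: e) +
    (\sum_(k | neg k) c k *: w k 0 + (0 - lm)%:C *: e).
  rewrite sum_pos_neg addrACA; congr (_ + _).
  by rewrite -scalerDl -rmorphD !sub0r -opprD rmorphN scaleNr.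
rewrite (le_trans (ler_nmD _ _)) // lerD //; apply: Em => //.
- by move=> k; rewrite raddfN oppr_gt0.
- move=> k t _; apply: hasD_eq; first exact: (hasD_comp_opp (dw k (- t))).
  by rewrite opprD scaleNr.
Qed.

(** Translation moves the point to [0]; the half-line estimates are used with the zero vector and
    with [e] times the primitives of the kernel norms. *)
Lemma bounded_solution_bound (w : 'I_n -> R -> X) (f : R -> X) (B : 'I_n -> R)
    (e : R) :
  (forall k t, hasD (w k) t (r k *: w k t + f t)) ->
  (forall k t, nm (w k t) <= B k) -> (forall t, nm (f t) <= e) ->
  forall t, nm (\sum_k c k *: w k t) <= (lp + lm) * e.
Proof.
move=> dw wB fe t.
have := @half_lines (fun k s => w k (t + s)) (fun s => f (t + s)) B 0
  (fun s => e * Phip s) (fun s => e * nm (gp s))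
  (fun s => e * Phim s) (fun s => e * nm (gm s)) (e * lp) (e * lm).
rewrite addr0 scaler0 subr0 Phip0 Phim0 mulr0 !subr0 -mulrDr [(lp + lm) * e]mulrC; apply.
- by move=> k s; exact: (hasD_shift (dw k (t + s))).
- by [].
- by apply: cvgM => //; exact: cvg_cst.
- by apply: cvgM => //; exact: cvg_cst.
- by move=> s _; rewrite scaler0 addr0 nmZ mulrC ler_wpM2r ?normc_ge0.
- by move=> s _; rewrite scaler0 addr0 nmZ nmN mulrC ler_wpM2r ?normc_ge0.
Qed.

Let hasD_exp (z : R[i]) (L : X) t :
  hasD (fun s => cexp (z * s%:C) *: L) t (z *: (cexp (z * t%:C) *: L)).
Proof. by rewrite scalerA; apply: hasD_Zl; exact: hasD_cexp. Qed.

Let asymptotics (w : 'I_n -> R -> X) (f : R -> X) (e : R) :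
  (forall k t, hasD (w k) t (r k *: w k t + f t)) -> (forall t, nm (f t) <= e) ->
  exists L : 'I_n -> X, forall k t,
    nm (w k t - cexp (r k * t%:C) *: L k) <= e / `|complex.Re (r k)|.
Proof.
move=> dw fe.
have [|L LP] := @choice _ _ (fun k L => forall t,
  nm (w k t - cexp (r k * t%:C) *: L) <= e / `|complex.Re (r k)|); last by exists L.
by move=> k; exact: ode_asymptotics (Re_r k) (dw k) fe.
Qed.

Let subtract_exp (w : 'I_n -> R -> X) (f : R -> X) (L : 'I_n -> X) :
  (forall k t, hasD (w k) t (r k *: w k t + f t)) ->
  forall k t, hasD (fun s => w k s - cexp (r k * s%:C) *: L k) t
    (r k *: (w k t - cexp (r k * t%:C) *: L k) + f t).
Proof.
move=> dw k t; apply: hasD_eq.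
  by apply: hasD_B; [exact: dw|exact: hasD_exp].
by rewrite scalerBr addrAC.
Qed.

Lemma Green_norm_is_Ulam : is_Ulam_constant X a (lp + lm).
Proof.
have l0 : 0 <= lp + lm.
  have := @bounded_solution_bound (fun _ _ => 0) (fun=> 0) (fun=> 0) 1.
  rewrite mulr1; move=> H; apply: le_trans (H _ _ _ 0); first exact: nm_ge0.
  - by move=> k t; rewrite scaler0 addr0; exact: hasD_cst.
  - by move=> k t; rewrite nm0.
  - by move=> t; rewrite nm0 ler01.
split=> // eps eps0 y yn ye.
have fe t : nm (Lop a y t) <= eps by rewrite -lecR -nmE.
have [w [dw yE]] := Cn_decomposition n_gt0 r_inj r_root yn.
have [L LP] := asymptotics dw fe.
have dz k t : hasD (fun s => cexp (r k * s%:C) *: L k) t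
    (r k *: (cexp (r k * t%:C) *: L k) + 0).
  by rewrite addr0; exact: hasD_exp.
exists (fun t => \sum_(k < n) c k *: (cexp (r k * t%:C) *: L k)); split.
  by apply: (Cn_solution n_gt0 r_inj dz) => t; exact: cvg_cst.
split=> [t|t]; first exact: (Lop_solution n_gt0 r_inj r_root dz).
rewrite nmE lecR yE -sumrB; under eq_bigr do rewrite -scalerBr.
exact: (@bounded_solution_bound _ _ (fun k => eps / `|complex.Re (r k)|) _
  (subtract_exp (L := L) dw) LP fe).
Qed.

(** With a right-hand side of norm at most one adapted to the phase of the Green kernel, the bounded
    solution at [0] is within [eps] of [lp + lm] times a unit vector. Only the zero solution of the
    homogeneous equation stays at bounded distance from it, so [K] bounds its norm. *)
Lemma Green_norm_le_Ulam (K : R) : (exists x : X, x != 0) ->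
  is_Ulam_constant X a K -> lp + lm <= K.
Proof.
move=> [x x0] [K0 HK].
have nx : 0 < nm x.
  by rewrite ltNge; apply: contra_neqN x0; exact: nm_eq0.
pose e := ((nm x)^-1)%:C *: x.
have e1 : nm e = 1.
  by rewrite nmZ normc_real ger0_norm ?invr_ge0 ?nm_ge0 // mulVf // gt_eqF.
pose C := \sum_(k < n) Normc.normc (c k).
have C0 : 0 <= C by apply: sumr_ge0 => k _; exact: normc_ge0.
have expsumC (P : pred 'I_n) (s : 'I_n -> R[i]) (t : R) :
    (forall k, P k -> 0 < complex.Re (s k)) -> 0 <= t -> nm (expsum P c s t) <= C.
  move=> s0 t0; rewrite (le_trans (le_nm_expsum _ _ _ _)) // /C.
  rewrite [leRHS](bigID P) /= ler_wpDr ?sumr_ge0 // => [k _|].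
    exact: normc_ge0.
  apply: ler_sum => k Pk; rewrite ler_piMr ?normc_ge0 // -expR0 ler_expR.
  by rewrite oppr_le0 mulr_ge0 // ltW // s0.
apply/ler_addgt0Pr => eps eps0.
(* Each phase error is at most [C * exp (- t / d) + d * exp (- t)], whose integral over the
   half-line is [(C + 1) * d = eps / 2]. *)
pose d := eps / (2 * (C + 1)).
have d0 : 0 < d by rewrite divr_gt0 // mulr_gt0 // ltr_wpDl.
have [pp [cpp pp0 pp1 ppE]] := approximate_phase d0 (@expsum_continuous R _ pos c r).
have [pm [cpm pm0 pm1 pmE]] :=
  approximate_phase d0 (@expsum_continuous R _ neg c (fun k => - r k)).
(* The two phases live on opposite half-lines, so [q] keeps norm at most one; the signs make both
   push the solution at [0] towards [+ e]. *)
pose q t : R[i]^o := pm (- t) - pp t.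
have cq t : q s @[s --> t] --> q t.
  apply: cvgB; last exact: cpp.
  by apply: (cvg_comp (fun s => - s) pm _ (cpm _)); exact: opp_continuous.
have q1 t : nm (q t) <= 1.
  have [t0|t0] := leP 0 t; first by rewrite /q pm0 ?oppr_le0 // sub0r nmN.
  by rewrite /q pp0 ?subr0 // ltW.
pose f t : X := q t *: e.
have f1 t : nm (f t) <= 1 by rewrite /f nmZ e1 mulr1 q1.
have cf t : f s @[s --> t] --> f t by apply: cvgZl; exact: cq.
have [H HP] : exists H : 'I_n -> R -> R[i]^o, forall k t,
    hasD (H k) t (cexp (- r k * t%:C) * q t).
  have [|h hP] := @choice _ _ (fun k (h : R -> R[i]^o) => forall t,
    hasD h t (cexp (- r k * t%:C) * q t)); last by exists h.
  move=> k; apply: complex_antiderivative => t; apply: cvgM; last exact: cq.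
  exact: hasD_cvg (hasD_cexp (- r k) t).
(* Variation of constants; since [f] is a scalar function times [e], scalar primitives suffice. *)
pose w0 k t : X := cexp (r k * t%:C) *: (H k t *: e).
have dw0 k t : hasD (w0 k) t (r k *: w0 k t + f t).
  apply: hasD_eq.
    exact: (hasD_Z (hasD_cexp (r k) t) (hasD_Zl (e := e) (HP k t))).
  rewrite /w0 !scalerA; congr (_ + _); rewrite /f scalerA; congr (_ * _ *: _).
  by rewrite mulrA [cexp _ * cexp _]mulrC mulNr cexpN mul1r.
have [L LP] := asymptotics dw0 f1.
pose w k s := w0 k s - cexp (r k * s%:C) *: L k.
have dw : forall k t, hasD (w k) t (r k *: w k t + f t) :=
  subtract_exp (L := L) dw0.
pose y t := \sum_(k < n) c k *: w k t.
have yn : Cn n y by apply: (Cn_solution n_gt0 r_inj dw).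
have [t|z [zn [z0 yz]]] := HK 1 ltr01 y yn.
  by rewrite (Lop_solution n_gt0 r_inj r_root dw) nmE lecR.
have {}yz t : nm (y t - z t) <= K by have := yz t; rewrite nmE lecR mulr1.
have yB t : nm (y t) <= lp + lm.
  rewrite -[leRHS]mulr1.
  exact: (@bounded_solution_bound _ _ (fun k => 1 / `|complex.Re (r k)|) _ dw LP f1).
have [w' [dw' zE]] := Cn_decomposition n_gt0 r_inj r_root zn.
(* A zero right-hand side leaves no error in the asymptotics: the components of [z] are exact
   exponentials. *)
have [|L' LP'] := asymptotics (e := 0) dw'; first by move=> t; rewrite z0 nm0.
have {}zE t : z t = \sum_(k < n) cexp (r k * t%:C) *: (c k *: L' k).
  rewrite zE; apply: eq_bigr => k _; rewrite scalerA mulrC -scalerA.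
  congr (_ *: _); apply/eqP; rewrite -subr_eq0; apply/eqP/nm_eq0.
  by have := LP' k t; rewrite mul0r.
have u0 : forall k, c k *: L' k = 0.
  apply: (bounded_expsum_eq0 r_inj (B := lp + lm + K)) => // t; rewrite -zE.
  rewrite -[z t](subKr (y t)) (le_trans (ler_nmD _ _)) // lerD //.
  by rewrite nmN.
have {}yz : nm (y 0) <= K.
  have := yz 0; rewrite zE big1 ?subr0 // => k _.
  by rewrite u0 scaler0.
pose psi (t : R) := - (C * d * expR (- (d^-1 * t)) + d * expR (- (1 * t))).
have dpsi (t : R) : 0 <= t ->
    is_derive t 1 psi (C * expR (- (d^-1 * t)) + d * expR (- (1 * t))).
  move=> _; have H1 := is_derive_expRN d^-1 t; have H2 := is_derive_expRN 1 t.
  by apply: is_derive_eq; rewrite /GRing.scale /=; field; rewrite gt_eqF.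
have psil : psi x @[x --> +oo] --> (0 : R).
  rewrite -oppr0; apply: cvgN; rewrite -[0](addr0 0).
  apply: cvgD; [rewrite -[X in _ --> X](mulr0 (C * d))|rewrite -[X in _ --> X](mulr0 d)].
    by apply: cvgM; [exact: cvg_cst|apply: cvg_expRN; rewrite invr_gt0].
  by apply: cvgM; [exact: cvg_cst|exact: cvg_expRN].
have psi0 : 0 - psi 0 = eps / 2.
  rewrite /psi !mulr0 oppr0 expR0 !mulr1 sub0r opprK /d; field.
  by rewrite gt_eqF // ltr_wpDl.
have Hy := @half_lines _ _ (fun k => 1 / `|complex.Re (r k)|) e _ _ _ _ _ _
  dw LP dpsi psil dpsi psil.
have {Hy} : nm (y 0 - (lp + lm)%:C *: e) <= eps / 2 + eps / 2.
  rewrite -psi0; apply: Hy => t t0.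
    rewrite scalerA -scalerDl /q pm0 ?oppr_le0 // sub0r mulrN addrC -opprB scaleNr.
    rewrite nmN nmZ e1 mulr1 (le_trans (ppE t t0)) // lerD2r.
    by rewrite ler_wpM2r ?expR_ge0 // expsumC.
  rewrite -scalerN scalerA scalerN -scaleNr -scalerDl /q opprK (pp0 (- t)) ?oppr_le0 //.
  rewrite subr0 addrC -opprB scaleNr nmN nmZ e1 mulr1 (le_trans (pmE t t0)) // lerD2r.
  rewrite ler_wpM2r ?expR_ge0 // expsumC // => k.
  by rewrite raddfN oppr_gt0.
rewrite -splitr nm_distC => Hy.
have : lp + lm <= nm ((lp + lm)%:C *: e).
  by rewrite nmZ e1 mulr1 normc_real ler_norm.
move=> /le_trans; apply; rewrite -lerBlDl.
have := le_trans (ler_nm_dist _ _) Hy; lra.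
Qed.

End BestConstant.

(** * From the Green kernel to the Vandermonde formula *)

Section GreenIntegral.
Context {R : realType} {X : completeNormedModType R[i]} {n : nat}.
Variables (a r : 'I_n -> R[i]).
Hypothesis n_gt0 : (0 < n)%N.
Hypothesis r_inj : injective r.
Hypothesis r_root : forall k, root (charpoly a) (r k).
Hypothesis Re_r : forall k, complex.Re (r k) != 0.
Hypothesis X_neq0 : exists x : X, x != 0.

(** Indices start at [0], so [k.+1] is the usual exponent. The sign [(-1) ^+ n] is common to all [k]
    and disappears in absolute values. *)
Lemma Vand_lagrange_weight (k : 'I_n) :
  (-1) ^+ k.+1 * Vand_del r k = (-1) ^+ n * Vand r * lagrange_weight r k.
Proof.
rewrite (Vand_delE r k) /lagrange_weight; set q := (cofactor_poly r k).[r k].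
have q0 : q != 0 by exact: horner_cofactor_neq0.
have -> : (-1) ^+ n = (-1) ^+ (n - k.+1) * (-1) ^+ k.+1 :> R[i].
  by rewrite -exprD subnK.
have S : (-1) ^+ (n - k.+1) * (-1) ^+ (n - k.+1) = 1 :> R[i].
  by rewrite -expr2 sqrr_sign.
transitivity (((-1) ^+ (n - k.+1) * (-1) ^+ (n - k.+1)) * (q * q^-1) *
  ((-1) ^+ k.+1 * Vand_del r k)); last by ring.
by rewrite S divff // !mul1r.
Qed.

Lemma normc_Vand_expsum (P : pred 'I_n) (s : 'I_n -> R[i]) (x : R) :
  Normc.normc (\sum_(k < n | P k) (-1) ^+ k.+1 * Vand_del r k * cexp (s k * x%:C)) =
  Normc.normc (Vand r) * nm (expsum P (lagrange_weight r) (fun k => - s k) x).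
Proof.
rewrite nm_normc /expsum.
under eq_bigr do rewrite Vand_lagrange_weight -mulrA.
under [in RHS]eq_bigr do rewrite opprK.
rewrite -mulr_sumr !Normc.normcM; congr (_ * _).
by rewrite -signr_odd; case: (odd n); rewrite ?expr1 ?expr0 ?normcN Normc.normc1 mul1r.
Qed.

Local Notation mu := (@lebesgue_measure R).

Lemma nm_expsum_measurable (P : pred 'I_n) (c s : 'I_n -> R[i]) (D : set R) :
  measurable_fun D (fun x : R => nm (expsum P c s x)).
Proof.
apply: measurable_funTS; apply: continuous_measurable_fun.
by move=> x; apply: cvg_nm; exact: expsum_continuous.
Qed.

(** The predicates are only required to agree pointwise with the sign conditions, so that the three
    cases arise from constant predicates or from comparison with [p]. *)
Lemma best_Ulam_constant_integral (P N : pred 'I_n) :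
  (forall k, P k = (0 < complex.Re (r k))) ->
  (forall k, N k = (complex.Re (r k) < 0)) ->
  exists K : R, is_best_Ulam_constant X a K /\
    K%:E = ((Normc.normc (Vand r))^-1%:E * \int[mu]_(x in `[0%R, +oo[)
      (Normc.normc (\sum_(k < n | P k) (-1) ^+ k.+1 * Vand_del r k * cexp (- r k * x%:C))
       + Normc.normc (\sum_(k < n | N k)
           (-1) ^+ k.+1 * Vand_del r k * cexp (r k * x%:C)))%:E)%E.
Proof.
move=> PE NE.
pose P' : pred 'I_n := fun k => 0 < complex.Re (r k).
pose N' : pred 'I_n := fun k => complex.Re (r k) < 0.
have {PE}-> : P = P' by apply/funext.
have {NE}-> : N = N' by apply/funext.
pose c := lagrange_weight r.
have [Phip [lp [Phip0 dPhip Phipl Ip]]] :=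
  @expsum_norm_integral R _ P' c r (fun k Pk => Pk).
have [|Phim [lm [Phim0 dPhim Phiml Im]]] :=
  @expsum_norm_integral R _ N' c (fun k => - r k).
  by move=> k; rewrite raddfN oppr_gt0.
exists (lp + lm); split.
  split; first exact: (Green_norm_is_Ulam n_gt0 r_inj r_root Re_r Phip0 Phim0).
  by move=> K'; exact: (Green_norm_le_Ulam n_gt0 r_inj r_root Re_r Phip0 Phim0).
have V0 : Normc.normc (Vand r) != 0.
  rewrite /Vand; apply: contraNneq (vandermonde_neq0 (s := [seq r i | i <- enum 'I_n]) _).
    by move=> /Normc.eq0_normc ->.
  by rewrite map_inj_uniq ?enum_uniq.
have rNN : (fun k => - - r k) = r by apply/funext => k; rewrite opprK.
have Ep (x : R) : Normc.normc (\sum_(k < n | P' k)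
    (-1) ^+ k.+1 * Vand_del r k * cexp (- r k * x%:C)) =
    Normc.normc (Vand r) * nm (expsum P' c r x).
  apply: etrans (normc_Vand_expsum P' (fun k => - r k) x) _.
  exact: (congr1 (fun s => Normc.normc (Vand r) * nm (expsum P' c s x)) rNN).
have Em (x : R) := normc_Vand_expsum N' r x.
under eq_integral => x _.
  rewrite Ep Em -mulrDr.
  rewrite EFinM EFinD.
  over.
rewrite ge0_integralZl_EFin //; last 3 first.
- by move=> x _; rewrite -EFinD lee_fin addr_ge0 ?nm_ge0.
- by apply: emeasurable_funD; apply/measurable_EFinP; exact: nm_expsum_measurable.
- exact: normc_ge0.
rewrite ge0_integralD //; last 4 first.
- by move=> x _; rewrite lee_fin nm_ge0.
- by apply/measurable_EFinP; exact: nm_expsum_measurable.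
- by move=> x _; rewrite lee_fin nm_ge0.
- by apply/measurable_EFinP; exact: nm_expsum_measurable.
by rewrite Im Ip muleA -EFinM mulVf // mul1r.
Qed.

End GreenIntegral.

Theorem theorem2 (R : realType) (X : completeNormedModType R[i])
  (n : nat) (a : 'I_n -> R[i]) (r : 'I_n -> R[i]) :
  (exists x : X, x != 0) ->
  (0 < n)%N ->
  injective r ->
  (forall k, root (charpoly a) (r k)) ->
  (forall k, complex.Re (r k) != 0) ->
  [/\
   (* (i) *)
   (forall k, 0 < complex.Re (r k)) ->
     exists K : R, is_best_Ulam_constant X a K /\
       K%:E = mule ((ComplexField.Normc.normc (Vand r))^-1)%:E
         (\int[@lebesgue_measure R]_(x in `[0%R, +oo[)
            (ComplexField.Normc.normc (\sum_(k < n) (-1) ^+ k.+1 * Vand_del r k * cexp (- r k * x%:C)))%:E)%E,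
   (* (ii) *)
   (forall k, complex.Re (r k) < 0) ->
     exists K : R, is_best_Ulam_constant X a K /\
       K%:E = mule ((ComplexField.Normc.normc (Vand r))^-1)%:E
         (\int[@lebesgue_measure R]_(x in `[0%R, +oo[)
            (ComplexField.Normc.normc (\sum_(k < n) (-1) ^+ k.+1 * Vand_del r k * cexp (r k * x%:C)))%:E)%E
   & (* (iii) *)
   forall p : nat, (0 < p < n)%N ->
     (forall k : 'I_n, (k < p)%N -> 0 < complex.Re (r k)) ->
     (forall k : 'I_n, (p <= k)%N -> complex.Re (r k) < 0) ->
     exists K : R, is_best_Ulam_constant X a K /\
       K%:E = mule ((ComplexField.Normc.normc (Vand r))^-1)%:E
         (\int[@lebesgue_measure R]_(x in `[0%R, +oo[)
            (ComplexField.Normc.normc (\sum_(k < n | (k < p)%N)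
                       (-1) ^+ k.+1 * Vand_del r k * cexp (- r k * x%:C))
             + ComplexField.Normc.normc (\sum_(k < n | (p <= k)%N)
                       (-1) ^+ k.+1 * Vand_del r k * cexp (r k * x%:C)))%:E)%E].
Proof.
move=> X0 n0 ri rr Rr; have best := best_Ulam_constant_integral n0 ri rr Rr X0.
split=> [pos|neg|p /andP[p0 pn] pos neg].
- have [|k|K [Kb KE]] := best predT pred0; first by move=> k; rewrite pos.
    by rewrite ltNge ltW.
  exists K; split => //; rewrite KE; congr (_ * _)%E; apply: eq_integral => x _.
  by rewrite big_pred0_eq Normc.normc0 addr0.
- have [k||K [Kb KE]] := best pred0 predT; last 1 first.
  + exists K; split => //; rewrite KE; congr (_ * _)%E; apply: eq_integral => x _.
    by rewrite big_pred0_eq Normc.normc0 add0r.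
  + by rewrite ltNge ltW.
  + by move=> k; rewrite neg.
apply: best => k; have [kp|pk] := ltnP k p.
- by rewrite pos.
- by rewrite ltNge ltW ?neg.
- by rewrite ltNge ltW ?pos.
- by rewrite neg.
Qed.
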